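(* Let $\mathcal C,\mathcal D$ be unitary fusion categories and ${}_{\mathcal C}\mathcal M_{\mathcal D}$ an indecomposable finitely semisimple unitary bimodule category with $d^L_m=d^R_m=d_m$ for all $m\in\mathrm{Irr}(\mathcal M)$. The bilinear map $p:\mathbf{Tube}_{\rm bd}(\mathcal M_{\mathcal D})\times\mathbf{Tube}_{\rm bd}({}_{\mathcal C}\mathcal M)\to\mathbb C$ defined in the context is a skew-pairing of weak Hopf algebras.
   Context: Associators are suppressed. $\mathrm{Irr}$: representatives of simple objects; $d_a$: quantum dimension; $\bar a$: dual; $R_a:\mathbb 1\to\bar a\otimes a$, $\bar R_a:\mathbb 1\to a\otimes\bar a$: standard balanced solutions of the conjugate equations ($(\bar R_a^\dagger\otimes \mathrm{id}_a)(\mathrm{id}_a\otimes R_a)=\mathrm{id}_a$, $(R_a^\dagger\otimes \mathrm{id}_{\bar a})(\mathrm{id}_{\bar a}\otimes\bar R_a)=\mathrm{id}_{\bar a}$, $R_a^\dagger R_a=\bar R_a^\dagger\bar R_a=d_a$). The left quantum dimensions $d^L_m>0$ satisfy $d_ad^L_m=\sum_n\dim\mathrm{Hom}(a\otimes m,n)d^L_n$ for $a\in \mathrm{Irr}(\mathcal C)$, the right ones $d^R_m>0$ satisfy $d^R_md_b=\sum_n\dim\mathrm{Hom}(m\otimes b,n)d^R_n$ for $b\in \mathrm{Irr}(\mathcal D)$ (only ratios matter). Dual bases $\tau,\tau^*$ of $\mathrm{Hom}(k,Y)$, $\mathrm{Hom}(Y,k)$ ($k$ simple) satisfy $\tau_i^*\tau_j=\delta_{ij}\mathrm{id}_k$.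 Left boundary tube algebra: $V=\mathbf{Tube}_{\rm bd}({}_{\mathcal C}\mathcal M)=\bigoplus_{a\in\mathrm{Irr}(\mathcal C)}\bigoplus_{x,y,z,w\in\mathrm{Irr}(\mathcal M)}\mathrm{Hom}(x,a\otimes y)\otimes\mathrm{Hom}(a\otimes z,w)$, elements $\nu\otimes\zeta$. Structure: $1=\sum_{x,z}\mathrm{id}_x\otimes\mathrm{id}_z$ ($a=\mathbb 1$); $(\nu\otimes\zeta)(\nu'\otimes\zeta')=\delta_{z,w'}\delta_{y,x'}\sum_{k,\tau}[(\tau^*\otimes\mathrm{id})(\mathrm{id}_a\otimes\nu')\nu]\otimes[\zeta(\mathrm{id}_a\otimes\zeta')(\tau\otimes\mathrm{id})]$ with $\tau$ over bases of $\mathrm{Hom}(k,a\otimes a')$; $\varepsilon(\nu\otimes\zeta)=0$ unless $y=z,x=w$, and then $\zeta\nu=\varepsilon(\nu\otimes\zeta)\mathrm{id}_x$; $\Delta(\nu\otimes\zeta)=\sum_{i,k,e}(e\otimes\zeta)\otimes(\nu\otimes e^* )$ with $e,e^*$ dual bases of $\mathrm{Hom}(k,a\otimes i)$, $\mathrm{Hom}(a\otimes i,k)$; $S(\nu\otimes\zeta)=\frac{d_z}{d_w}\hat\zeta\otimes\hat\nu$ with $\hat\zeta=(\mathrm{id}_{\bar a}\otimes\zeta)(R_a\otimes\mathrm{id}_z)$, $\hat\nu=(R_a^\dagger\otimes\mathrm{id}_y)(\mathrm{id}_{\bar a}\otimes\nu)$. Right boundary tube algebra: $U=\mathbf{Tube}_{\rm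 bd}(\mathcal M_{\mathcal D})=\bigoplus_{b\in\mathrm{Irr}(\mathcal D)}\bigoplus_{s,t,u,v\in\mathrm{Irr}(\mathcal M)}\mathrm{Hom}(s,t\otimes b)\otimes\mathrm{Hom}(u\otimes b,v)$, elements $\mu\otimes\gamma$. Structure: $1=\sum_{s,u}\mathrm{id}_s\otimes\mathrm{id}_u$; $(\mu\otimes\gamma)(\mu'\otimes\gamma')=\delta_{u,v'}\delta_{t,s'}\sum_{k,\sigma}[(\mathrm{id}\otimes\sigma^* )(\mu'\otimes\mathrm{id}_b)\mu]\otimes[\gamma(\gamma'\otimes\mathrm{id}_b)(\mathrm{id}\otimes\sigma)]$ with $\sigma$ over bases of $\mathrm{Hom}(k,b'\otimes b)$; $\varepsilon(\mu\otimes\gamma)=0$ unless $t=u$, $s=v$, and then $\gamma\mu=\varepsilon(\mu\otimes\gamma)\mathrm{id}_s$; $\Delta(\mu\otimes\gamma)=\sum_{i,k,e}(e\otimes\gamma)\otimes(\mu\otimes e^* )$ with $e,e^*$ dual bases of $\mathrm{Hom}(k,i\otimes b)$, $\mathrm{Hom}(i\otimes b,k)$; $S(\mu\otimes\gamma)=\frac{d_u}{d_v}\hat\gamma\otimes\hat\mu$ with $\hat\gamma=(\gamma\otimes\mathrm{id}_{\bar b})(\mathrm{id}_u\otimes\bar R_b)$, $\hat\mu=(\mathrm{id}_t\otimes\bar R_b^\dagger)(\mu\otimes\mathrm{id}_{\bar b})$. Both are weak Hopf algebras. The map $p$: for $\mu\otimes\gamma\in U$ with labels $(b;s,t,u,v)$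 and $\nu\otimes\zeta\in V$ with labels $(a;x,y,z,w)$, $p(\mu\otimes\gamma,\nu\otimes\zeta)=0$ unless $s=w$, $t=x$, $u=y$, $v=z$, in which case $$\zeta\circ(\mathrm{id}_a\otimes\gamma)\circ(\nu\otimes\mathrm{id}_b)\circ\mu=p(\mu\otimes\gamma,\nu\otimes\zeta)\,\mathrm{id}_s$$ (composite $s\to t\otimes b\to a\otimes u\otimes b\to a\otimes v\to s$; the middle associator of the bimodule category is suppressed). Skew-pairing of weak Hopf algebras with invertible antipodes: a bilinear $p:U\times V\to\mathbb C$ with $p(1_U,v)=\varepsilon_V(v)$, $p(u,1_V)=\varepsilon_U(u)$, $p(uu',v)=\sum p(u,v^{(1)})p(u',v^{(2)})$, $p(u,vv')=\sum p(u^{(2)},v)p(u^{(1)},v')$, $p(S_U(u),v)=p(u,S_V^{-1}(v))$. *)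

(* Defs.v *)
From HB Require Import structures.
From mathcomp Require Import all_boot all_order all_algebra.

Set Implicit Arguments.
Unset Strict Implicit.
Unset Printing Implicit Defensive.

Import Order.TTheory GRing.Theory Num.Theory.
Local Open Scope ring_scope.

Reserved Notation "g ∘ f" (at level 40, left associativity).
Reserved Notation "f ^†" (format "f ^†").
Reserved Notation "a ⊗ b" (at level 35, right associativity).
Reserved Notation "f ⊗⊗ g" (at level 35, right associativity).
Reserved Notation "a ▷ m" (at level 35, right associativity).
Reserved Notation "f ▷▷ g" (at level 35, right associativity).
Reserved Notation "m ◁ b" (at level 39, left associativity).
Reserved Notation "f ◁◁ g" (at level 39, left associativity).
Reserved Notation "A ⊠ B" (at level 35, right associativity).
Reserved Notation "u ⊠⊠ v" (at level 35, right associativity).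

(** * Tensor products and direct sums of finite dimensional vector spaces *)

Section Tensor.
Variable K : fieldType.
Implicit Types A B E : vectType K.

(* [A ⊗ B] in coordinates: the coefficients on [e_i ⊗ f_j], where [e] and [f]
   are the bases [vbasis {:A}] and [vbasis {:B}].  [ptens a b] is the pure
   tensor and [tlift f] the linear map induced by a bilinear [f]. *)
Definition tensv A B : vectType K := 'M[K]_(\dim {:A}, \dim {:B}).

Definition ptens A B (a : A) (b : B) : tensv A B :=
  \matrix_(i, j) (coord (vbasis {:A}) i a * coord (vbasis {:B}) j b).

Definition tlift A B E (f : A -> B -> E) (t : tensv A B) : E :=
  \sum_i \sum_j
    (t : 'M_(_, _)) i j *: f (tnth (vbasis {:A}) i) (tnth (vbasis {:B}) j).

Lemma tlift_ptens A B E (f : A -> B -> E) (a : A) (b : B) :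
  (forall b, linear (f^~ b)) -> (forall a, linear (f a)) ->
  tlift f (ptens a b) = f a b.
Proof.
move=> fl fr.
pose fL b0 := GRing.isLinear.Build K A E *:%R (f^~ b0) (fl b0).
pose fR a0 := GRing.isLinear.Build K B E *:%R (f a0) (fr a0).
pose gL b0 : {linear A -> E} := HB.pack (f^~ b0) (fL b0).
pose gR a0 : {linear B -> E} := HB.pack (f a0) (fR a0).
have lS I r (F : I -> A) y : f (\sum_(i <- r) F i) y = \sum_(i <- r) f (F i) y.
  exact: (linear_sum (gL y)).
have rS I r (F : I -> B) x : f x (\sum_(i <- r) F i) = \sum_(i <- r) f x (F i).
  exact: (linear_sum (gR x)).
have lE c x y : f (c *: x) y = c *: f x y by exact: (linearZ_LR (gL y)).
have rE c x y : f x (c *: y) = c *: f x y by exact: (linearZ_LR (gR x)).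
rewrite /tlift [in RHS](coord_vbasis (memvf a)) lS; apply: eq_bigr => i _.
rewrite [in RHS](coord_vbasis (memvf b)) rS; apply: eq_bigr => j _.
by rewrite mxE lE rE scalerA !(tnth_nth 0).
Qed.

(* The direct sum of the [T l], again in coordinates, with its injections and
   projections. *)
Definition dsum (L : finType) (T : L -> vectType K) : vectType K :=
  {ffun {l : L & 'I_(\dim {:T l})} -> K^o}.

Variables (L : finType) (T : L -> vectType K).

Definition dinj l (t : T l) : dsum T :=
  [ffun s => coord (vbasis {:T (tag s)}) (tagged s)
               (dfwith (fun l => 0 : T l) t (tag s))].

Definition dproj l (v : dsum T) : T l :=
  \sum_j (v : {ffun _ -> _}) (Tagged (fun l => 'I_(\dim {:T l})) j)
    *: tnth (vbasis {:T l}) j.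

Lemma dproj_dinj l (t : T l) l' :
  dproj l' (dinj t) = dfwith (fun l => 0 : T l) t l'.
Proof.
rewrite /dproj [RHS](coord_vbasis (memvf _)).
by apply: eq_bigr => j _; rewrite ffunE (tnth_nth 0).
Qed.

Lemma sum_dinj (v : dsum T) : \sum_l dinj (dproj l v) = v.
Proof.
apply/ffunP=> -[l j]; rewrite sum_ffunE (bigD1 l) //= big1 ?addr0.
  rewrite ffunE /= dfwith_in /dproj.
  under eq_bigr do rewrite (tnth_nth 0).
  by rewrite coord_sum_free // (basis_free (vbasisP _)).
move=> l' ne; rewrite ffunE /= dfwith_out //.
by rewrite linear0.
Qed.

End Tensor.

Notation "A ⊠ B" := (tensv A B).
Notation "a ⊠⊠ b" := (ptens a b).

(** * Weak Hopf data and skew-pairings *)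

Record wHopfData (K : fieldType) := WHopfData {
  wh_car :> vectType K;
  wh_one : wh_car;
  wh_mul : wh_car -> wh_car -> wh_car;
  wh_counit : wh_car -> K;
  wh_comul : wh_car -> wh_car ⊠ wh_car;
  wh_antipode : wh_car -> wh_car }.

(* The Sweedler sums [Σ f v⁽¹⁾ v⁽²⁾]. *)
Definition sweedler (K : fieldType) (V : wHopfData K) (f : V -> V -> K)
    (v : V) : K :=
  tlift (E := K^o) f (wh_comul v).

Record skew_pairing (K : fieldType) (U V : wHopfData K) (p : U -> V -> K)
    : Prop := SkewPairing {
  skew_linl : forall v : V, linear (fun u => p u v : K^o);
  skew_linr : forall u : U, linear (fun v => p u v : K^o);
  skew_1l : forall v : V, p (wh_one U) v = wh_counit v;
  skew_1r : forall u : U, p u (wh_one V) = wh_counit u;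
  skew_Ml : forall (u u' : U) (v : V),
    p (wh_mul u u') v = sweedler (fun v1 v2 => p u v1 * p u' v2) v;
  skew_Mr : forall (u : U) (v v' : V),
    p u (wh_mul v v') = sweedler (fun u1 u2 => p u2 v * p u1 v') u;
  skew_Sl_bij : bijective (@wh_antipode K U);
  skew_S : exists Sinv : V -> V,
    [/\ cancel (@wh_antipode K V) Sinv,
        cancel Sinv (@wh_antipode K V)
      & forall (u : U) (v : V), p (wh_antipode u) v = p u (Sinv v)] }.

(** * Unitary categories *)

(* Positivity of the dagger, together with finite dimensional hom spaces and
   the finite direct sums required below, makes this a C*-category. *)
Record unitaryCat (K : numClosedFieldType) := UnitaryCat {
  obj :> Type;
  hom : obj -> obj -> vectType K;
  idm : forall x, hom x x;
  comp : forall x y z, hom y z -> hom x y -> hom x z;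
  dag : forall x y, hom x y -> hom y x;
  comp_linl : forall x y z (f : hom x y), linear (fun g : hom y z => comp g f);
  comp_linr : forall x y z (g : hom y z), linear (fun f : hom x y => comp g f);
  compA : forall x y z t (h : hom z t) (g : hom y z) (f : hom x y),
    comp h (comp g f) = comp (comp h g) f;
  comp1m : forall x y (f : hom x y), comp (idm y) f = f;
  compm1 : forall x y (f : hom x y), comp f (idm x) = f;
  dag_antilin : forall x y (c : K) (f g : hom x y),
    dag (c *: f + g) = c^* *: dag f + dag g;
  dagK : forall x y (f : hom x y), dag (dag f) = f;
  dag_id : forall x, dag (idm x) = idm x;
  dag_comp : forall x y z (g : hom y z) (f : hom x y),
    dag (comp g f) = comp (dag f) (dag g);
  dag_pos : forall x y (f : hom x y), comp (dag f) f = 0 -> f = 0 }.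

Arguments hom {K u} x y.
Arguments idm {K u} x.
Notation "g ∘ f" := (comp g f).
Notation "f ^†" := (dag f).

Section CatNotions.
Variables (K : numClosedFieldType) (A : unitaryCat K).
Implicit Types x y z : A.

Definition unitary x y (f : hom x y) : Prop :=
  f^† ∘ f = idm x /\ f ∘ f^† = idm y.

Definition iso x y : Prop :=
  exists (f : hom x y) (g : hom y x), g ∘ f = idm x /\ f ∘ g = idm y.

Definition zero_obj x : Prop := idm x = 0.

Definition simple x : Prop := \dim {:hom x x} = 1%N.

Definition direct_sum n (x : 'I_n -> A) (s : A) : Prop :=
  exists i : forall j, hom (x j) s,
    [/\ forall j, (i j)^† ∘ i j = idm (x j),
        forall j k, j != k -> (i j)^† ∘ i k = 0
      & \sum_j i j ∘ (i j)^† = idm s].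

Definition has_direct_sums : Prop :=
  forall n (x : 'I_n -> A), exists s, direct_sum x s.

Definition semisimple : Prop :=
  forall x, exists n (k : 'I_n -> A),
    (forall j, simple (k j)) /\ direct_sum k x.

Record irreps := Irreps {
  irr_idx :> finType;
  irr : irr_idx -> A;
  irr_simple : forall i, simple (irr i);
  irr_inj : forall i j, iso (irr i) (irr j) -> i = j;
  irr_all : forall x, simple x -> exists i, iso x (irr i) }.

(* [scal f] is the [c] with [f = c *: idm x], for [x] simple. *)
Definition scal x (f : hom x x) : K := coord [tuple idm x] ord0 f.

Record dual_bases x y := DualBases {
  db_size : nat;
  db : db_size.-tuple (hom x y);
  db' : db_size.-tuple (hom y x);
  db_basis : basis_of {:hom x y} db;
  db'_basis : basis_of {:hom y x} db';
  db_dual : forall i j, tnth db' i ∘ tnth db j = (i == j)%:R *: idm x }.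

End CatNotions.


Record semisimpleCat (K : numClosedFieldType) := SemisimpleCat {
  ss_cat :> unitaryCat K;
  ss_sums : has_direct_sums ss_cat;
  ss_semisimple : semisimple ss_cat;
  Irr : irreps ss_cat }.

(* A choice of dual bases of [Hom(k, Y)] and [Hom(Y, k)] for all [k], [Y]. *)
Definition dual_bases_system (K : numClosedFieldType) (A : semisimpleCat K) :=
  forall (k : Irr A) (Y : A), dual_bases (irr k) Y.

(** * Tensor categories and (bi)module categories *)

Record bifunctor (K : numClosedFieldType) (A B E : unitaryCat K) := Bifunctor {
  bobj : A -> B -> E;
  bhom : forall a a' b b',
    hom a a' -> hom b b' -> hom (bobj a b) (bobj a' b');
  bhom_linl : forall a a' b b' (g : hom b b'),
    linear (fun f : hom a a' => bhom f g);
  bhom_linr : forall a a' b b' (f : hom a a'),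
    linear (fun g : hom b b' => bhom f g);
  bhom_id : forall a b, bhom (idm a) (idm b) = idm (bobj a b);
  bhom_comp : forall a a' a'' b b' b''
      (f' : hom a' a'') (f : hom a a') (g' : hom b' b'') (g : hom b b'),
    bhom (f' ∘ f) (g' ∘ g) = bhom f' g' ∘ bhom f g;
  bhom_dag : forall a a' b b' (f : hom a a') (g : hom b b'),
    (bhom f g)^† = bhom f^† g^† }.

Section TensorAxioms.
Variables (K : numClosedFieldType) (A : unitaryCat K) (T : bifunctor A A A).
Local Notation "a ⊗ b" := (bobj T a b).
Local Notation "f ⊗⊗ g" := (bhom T f g).
Variables (one : A)
  (assoc : forall a b c, hom ((a ⊗ b) ⊗ c) (a ⊗ (b ⊗ c)))
  (lunit : forall a, hom (one ⊗ a) a)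
  (runit : forall a, hom (a ⊗ one) a).

Record tensor_axioms : Prop := TensorAxioms {
  ta_assoc_unitary : forall a b c, unitary (assoc a b c);
  ta_lunit_unitary : forall a, unitary (lunit a);
  ta_runit_unitary : forall a, unitary (runit a);
  ta_assoc_nat : forall a a' b b' c c'
      (f : hom a a') (g : hom b b') (h : hom c c'),
    (f ⊗⊗ (g ⊗⊗ h)) ∘ assoc a b c = assoc a' b' c' ∘ ((f ⊗⊗ g) ⊗⊗ h);
  ta_lunit_nat : forall a a' (f : hom a a'),
    f ∘ lunit a = lunit a' ∘ (idm one ⊗⊗ f);
  ta_runit_nat : forall a a' (f : hom a a'),
    f ∘ runit a = runit a' ∘ (f ⊗⊗ idm one);
  ta_pentagon : forall a b c d,
    (idm a ⊗⊗ assoc b c d) ∘ assoc a (b ⊗ c) d ∘ (assoc a b c ⊗⊗ idm d)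
    = assoc a b (c ⊗ d) ∘ assoc (a ⊗ b) c d;
  ta_triangle : forall a b,
    (idm a ⊗⊗ lunit b) ∘ assoc a one b = runit a ⊗⊗ idm b }.

End TensorAxioms.

Record tensorStr (K : numClosedFieldType) (A : unitaryCat K) := TensorStr {
  tens : bifunctor A A A;
  tone : A;
  tassoc : forall a b c,
    hom (bobj tens (bobj tens a b) c) (bobj tens a (bobj tens b c));
  tlunit : forall a, hom (bobj tens tone a) a;
  trunit : forall a, hom (bobj tens a tone) a;
  tens_axioms : tensor_axioms tassoc tlunit trunit }.

Section Conjugates.
Variables (K : numClosedFieldType) (A : unitaryCat K) (T : tensorStr A).
Local Notation "a ⊗ b" := (bobj (tens T) a b).
Local Notation "f ⊗⊗ g" := (bhom (tens T) f g).

Definition conjugate_eqs (a a' : A) (R : hom (tone T) (a' ⊗ a))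
    (R' : hom (tone T) (a ⊗ a')) : Prop :=
  tlunit T a ∘ (R'^† ⊗⊗ idm a) ∘ (tassoc T a a' a)^† ∘ (idm a ⊗⊗ R)
    ∘ (trunit T a)^† = idm a
  /\ tlunit T a' ∘ (R^† ⊗⊗ idm a') ∘ (tassoc T a' a a')^† ∘ (idm a' ⊗⊗ R')
    ∘ (trunit T a')^† = idm a'.

Definition rigid : Prop :=
  forall a : A, exists (a' : A) (R : hom (tone T) (a' ⊗ a))
    (R' : hom (tone T) (a ⊗ a')), conjugate_eqs R R'.

End Conjugates.

Record unitaryFusionCat (K : numClosedFieldType) := UnitaryFusionCat {
  uf_cat :> semisimpleCat K;
  uf_tens : tensorStr uf_cat;
  uf_one_simple : simple (tone uf_tens);
  uf_rigid : rigid uf_tens }.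

(* [st_iso] identifies the unit object with its representative in [Irr C]
   (the identity if that representative is the unit itself); [bar], [st_R],
   [st_R'] are duals of simple objects with standard solutions. *)
Record standard_data (K : numClosedFieldType) (C : unitaryFusionCat K) :=
  StandardData {
  st_one : Irr C;
  st_iso : hom (tone (uf_tens C)) (irr st_one);
  st_iso_unitary : unitary st_iso;
  bar : Irr C -> Irr C;
  st_R : forall a,
    hom (tone (uf_tens C)) (bobj (tens (uf_tens C)) (irr (bar a)) (irr a));
  st_R' : forall a,
    hom (tone (uf_tens C)) (bobj (tens (uf_tens C)) (irr a) (irr (bar a)));
  qdim : Irr C -> K;
  st_conj : forall a, conjugate_eqs (st_R a) (st_R' a);
  st_R_dim : forall a,
    (st_R a)^† ∘ st_R a = qdim a *: idm (tone (uf_tens C));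
  st_R'_dim : forall a,
    (st_R' a)^† ∘ st_R' a = qdim a *: idm (tone (uf_tens C)) }.

Section LeftModuleAxioms.
Variables (K : numClosedFieldType) (A M : unitaryCat K) (T : tensorStr A).
Variable F : bifunctor A M M.
Local Notation "a ⊗ b" := (bobj (tens T) a b).
Local Notation "a ▷ m" := (bobj F a m).
Local Notation "f ▷▷ g" := (bhom F f g).
Variables (assoc : forall a b m, hom ((a ⊗ b) ▷ m) (a ▷ (b ▷ m)))
  (unit : forall m, hom (tone T ▷ m) m).

Record left_module_axioms : Prop := LeftModuleAxioms {
  lm_assoc_unitary : forall a b m, unitary (assoc a b m);
  lm_unit_unitary : forall m, unitary (unit m);
  lm_assoc_nat : forall a a' b b' m m'
      (f : hom a a') (g : hom b b') (h : hom m m'),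
    (f ▷▷ (g ▷▷ h)) ∘ assoc a b m
    = assoc a' b' m' ∘ (bhom (tens T) f g ▷▷ h);
  lm_unit_nat : forall m m' (f : hom m m'),
    f ∘ unit m = unit m' ∘ (idm (tone T) ▷▷ f);
  lm_pentagon : forall a b c m,
    (idm a ▷▷ assoc b c m) ∘ assoc a (b ⊗ c) m ∘ (tassoc T a b c ▷▷ idm m)
    = assoc a b (c ▷ m) ∘ assoc (a ⊗ b) c m;
  lm_triangle : forall a m,
    (idm a ▷▷ unit m) ∘ assoc a (tone T) m = trunit T a ▷▷ idm m }.

End LeftModuleAxioms.

Record leftModule (K : numClosedFieldType) (A : unitaryCat K)
    (T : tensorStr A) (M : unitaryCat K) := LeftModule {
  lact : bifunctor A M M;
  lassoc : forall a b m,
    hom (bobj lact (bobj (tens T) a b) m) (bobj lact a (bobj lact b m));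
  lunit : forall m, hom (bobj lact (tone T) m) m;
  lact_axioms : left_module_axioms lassoc lunit }.

Section RightModuleAxioms.
Variables (K : numClosedFieldType) (M A : unitaryCat K) (T : tensorStr A).
Variable G : bifunctor M A M.
Local Notation "a ⊗ b" := (bobj (tens T) a b).
Local Notation "m ◁ b" := (bobj G m b).
Local Notation "f ◁◁ g" := (bhom G f g).
Variables (assoc : forall m b c, hom ((m ◁ b) ◁ c) (m ◁ (b ⊗ c)))
  (unit : forall m, hom (m ◁ tone T) m).

Record right_module_axioms : Prop := RightModuleAxioms {
  rm_assoc_unitary : forall m b c, unitary (assoc m b c);
  rm_unit_unitary : forall m, unitary (unit m);
  rm_assoc_nat : forall m m' b b' c c'
      (f : hom m m') (g : hom b b') (h : hom c c'),
    (f ◁◁ bhom (tens T) g h) ∘ assoc m b c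
    = assoc m' b' c' ∘ ((f ◁◁ g) ◁◁ h);
  rm_unit_nat : forall m m' (f : hom m m'),
    f ∘ unit m = unit m' ∘ (f ◁◁ idm (tone T));
  rm_pentagon : forall m a b c,
    (idm m ◁◁ tassoc T a b c) ∘ assoc m (a ⊗ b) c ∘ (assoc m a b ◁◁ idm c)
    = assoc m a (b ⊗ c) ∘ assoc (m ◁ a) b c;
  rm_triangle : forall m b,
    (idm m ◁◁ tlunit T b) ∘ assoc m (tone T) b = unit m ◁◁ idm b }.

End RightModuleAxioms.

Record rightModule (K : numClosedFieldType) (M A : unitaryCat K)
    (T : tensorStr A) := RightModule {
  ract : bifunctor M A M;
  rassoc : forall m b c,
    hom (bobj ract (bobj ract m b) c) (bobj ract m (bobj (tens T) b c));
  runit : forall m, hom (bobj ract m (tone T)) m;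
  ract_axioms : right_module_axioms rassoc runit }.

Arguments rightModule [K] M [A] T.

Section BimoduleAxioms.
Variables (K : numClosedFieldType) (C M D : unitaryCat K).
Variables (S : tensorStr C) (T : tensorStr D).
Variables (F : leftModule S M) (G : rightModule M T).
Local Notation "a ⊗ b" := (bobj (tens _) a b).
Local Notation "a ▷ m" := (bobj (lact F) a m).
Local Notation "f ▷▷ g" := (bhom (lact F) f g).
Local Notation "m ◁ b" := (bobj (ract G) m b).
Local Notation "f ◁◁ g" := (bhom (ract G) f g).
Variable mid : forall a m b, hom ((a ▷ m) ◁ b) (a ▷ (m ◁ b)).

Record bimodule_axioms : Prop := BimoduleAxioms {
  bm_unitary : forall a m b, unitary (mid a m b);
  bm_nat : forall a a' m m' b b'
      (f : hom a a') (g : hom m m') (h : hom b b'),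
    (f ▷▷ (g ◁◁ h)) ∘ mid a m b = mid a' m' b' ∘ ((f ▷▷ g) ◁◁ h);
  bm_pentagon_l : forall a a' m b,
    (idm a ▷▷ mid a' m b) ∘ mid a (a' ▷ m) b ∘ (lassoc F a a' m ◁◁ idm b)
    = lassoc F a a' (m ◁ b) ∘ mid (bobj (tens S) a a') m b;
  bm_pentagon_r : forall a m b b',
    (idm a ▷▷ rassoc G m b b') ∘ mid a (m ◁ b) b' ∘ (mid a m b ◁◁ idm b')
    = mid a m (bobj (tens T) b b') ∘ rassoc G (a ▷ m) b b';
  bm_triangle_l : forall m b,
    lunit F (m ◁ b) ∘ mid (tone S) m b = lunit F m ◁◁ idm b;
  bm_triangle_r : forall a m,
    (idm a ▷▷ runit G m) ∘ mid a m (tone T) = runit G (a ▷ m) }.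

End BimoduleAxioms.

Record bimodule (K : numClosedFieldType) (C D : unitaryFusionCat K)
    (M : semisimpleCat K) := Bimodule {
  bl : leftModule (uf_tens C) M;
  br : rightModule M (uf_tens D);
  bmid : forall a m b,
    hom (bobj (ract br) (bobj (lact bl) a m) b)
        (bobj (lact bl) a (bobj (ract br) m b));
  bmid_axioms : bimodule_axioms bmid }.

(* [M] is nonzero and in every decomposition of [M] as a direct sum of two
   full subcategories stable under both actions, one of them is zero. *)
Definition indecomposable (K : numClosedFieldType) (C D : unitaryFusionCat K)
    (M : semisimpleCat K) (B : bimodule C D M) : Prop :=
  (exists m : M, ~ zero_obj m) /\
  forall P0 P1 : M -> Prop,
    let stable P := forall (a : C) (m : M) (b : D), P m ->
      P (bobj (lact (bl B)) a m) /\ P (bobj (ract (br B)) m b) in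
    stable P0 -> stable P1 ->
    (forall m0 m1 (f : hom m0 m1), P0 m0 -> P1 m1 -> f = 0) ->
    (forall m, exists m0 m1, [/\ P0 m0, P1 m1 &
       direct_sum (fun i : 'I_2 => if i == ord0 then m0 else m1) m]) ->
    (forall m, P0 m -> zero_obj m) \/ (forall m, P1 m -> zero_obj m).

(** * The left boundary tube algebra *)

Section LeftTube.
Variables (K : numClosedFieldType) (C : unitaryFusionCat K).
Variables (M : semisimpleCat K) (L : leftModule (uf_tens C) M).
Local Notation "a ▷ m" := (bobj (lact L) a m).
Local Notation "f ▷▷ g" := (bhom (lact L) f g).

Definition left_dims (sC : standard_data C) (d : Irr M -> K) : Prop :=
  (forall m, 0 < d m) /\
  forall (a : Irr C) (m : Irr M),
    qdim sC a * d m = \sum_n (\dim {:hom (irr a ▷ irr m) (irr n)})%:R * d n.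

Variables (sC : standard_data C) (tC : dual_bases_system C).
Variables (tM : dual_bases_system M) (d : Irr M -> K).

Local Notation u1 := (st_iso sC).

(* A label is [(a, x, y, z, w)]. *)
Definition ltube_label : finType := (Irr C * Irr M * Irr M * Irr M * Irr M)%type.

Definition ltube_block (l : ltube_label) : vectType K :=
  let: (a, x, y, z, w) := l in
  hom (irr x) (irr a ▷ irr y) ⊠ hom (irr a ▷ irr z) (irr w).

Definition ltube : vectType K := dsum ltube_block.

Definition lelt a x y z w (nu : hom (irr x) (irr a ▷ irr y))
    (zeta : hom (irr a ▷ irr z) (irr w)) : ltube :=
  dinj (l := (a, x, y, z, w) : ltube_label) (nu ⊠⊠ zeta).

Definition lpart (v : ltube) a x y z w :
    hom (irr x) (irr a ▷ irr y) ⊠ hom (irr a ▷ irr z) (irr w) :=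
  dproj ((a, x, y, z, w) : ltube_label) v.

Definition ltube_one : ltube :=
  \sum_x \sum_z
    lelt (((u1 ▷▷ idm (irr x)) ∘ (lunit L (irr x))^†))
         (lunit L (irr z) ∘ (u1^† ▷▷ idm (irr z))).

Definition ltube_mul (v v' : ltube) : ltube :=
  \sum_a \sum_x \sum_y \sum_z \sum_w \sum_a' \sum_y' \sum_z'
  tlift (fun nu zeta => tlift (fun nu' zeta' =>
    \sum_k \sum_(i < db_size (tC k (bobj (tens (uf_tens C)) (irr a) (irr a'))))
      let tau := tnth (db (tC k _)) i in
      let tau' := tnth (db' (tC k _)) i in
      lelt ((tau' ▷▷ idm (irr y')) ∘ (lassoc L (irr a) (irr a') (irr y'))^†
              ∘ (idm (irr a) ▷▷ nu') ∘ nu)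
           (zeta ∘ (idm (irr a) ▷▷ zeta') ∘ lassoc L (irr a) (irr a') (irr z')
              ∘ (tau ▷▷ idm (irr z'))))
    (lpart v' a' y y' z' z)) (lpart v a x y z w).

Definition ltube_counit (v : ltube) : K :=
  \sum_a \sum_x \sum_y
    tlift (E := K^o) (fun nu zeta => scal (zeta ∘ nu)) (lpart v a x y y x).

Definition ltube_comul (v : ltube) : ltube ⊠ ltube :=
  \sum_a \sum_x \sum_y \sum_z \sum_w
  tlift (fun nu zeta =>
    \sum_i \sum_k \sum_(j < db_size (tM k (irr a ▷ irr i)))
      lelt (tnth (db (tM k (irr a ▷ irr i))) j) zeta
        ⊠⊠ lelt nu (tnth (db' (tM k (irr a ▷ irr i))) j))
    (lpart v a x y z w).

Definition ltube_antipode (v : ltube) : ltube :=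
  \sum_a \sum_x \sum_y \sum_z \sum_w
  tlift (fun nu zeta =>
    (d z / d w) *:
    lelt ((idm (irr (bar sC a)) ▷▷ zeta)
            ∘ lassoc L (irr (bar sC a)) (irr a) (irr z)
            ∘ (st_R sC a ▷▷ idm (irr z)) ∘ (lunit L (irr z))^†)
         (lunit L (irr y) ∘ ((st_R sC a)^† ▷▷ idm (irr y))
            ∘ (lassoc L (irr (bar sC a)) (irr a) (irr y))^†
            ∘ (idm (irr (bar sC a)) ▷▷ nu)))
    (lpart v a x y z w).

Definition left_tube : wHopfData K :=
  WHopfData ltube_one ltube_mul ltube_counit ltube_comul ltube_antipode.

End LeftTube.

(** * The right boundary tube algebra *)

Section RightTube.
Variables (K : numClosedFieldType) (D : unitaryFusionCat K).
Variables (M : semisimpleCat K) (G : rightModule M (uf_tens D)).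
Local Notation "m ◁ b" := (bobj (ract G) m b).
Local Notation "f ◁◁ g" := (bhom (ract G) f g).

Definition right_dims (sD : standard_data D) (d : Irr M -> K) : Prop :=
  (forall m, 0 < d m) /\
  forall (m : Irr M) (b : Irr D),
    d m * qdim sD b = \sum_n (\dim {:hom (irr m ◁ irr b) (irr n)})%:R * d n.

Variables (sD : standard_data D) (tD : dual_bases_system D).
Variables (tM : dual_bases_system M) (d : Irr M -> K).

Local Notation u1 := (st_iso sD).

(* A label is [(b, s, t, u, v)]. *)
Definition rtube_label : finType := (Irr D * Irr M * Irr M * Irr M * Irr M)%type.

Definition rtube_block (l : rtube_label) : vectType K :=
  let: (b, s, t, u, v) := l in
  hom (irr s) (irr t ◁ irr b) ⊠ hom (irr u ◁ irr b) (irr v).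

Definition rtube : vectType K := dsum rtube_block.

Definition relt b s t u v (mu : hom (irr s) (irr t ◁ irr b))
    (gamma : hom (irr u ◁ irr b) (irr v)) : rtube :=
  dinj (l := (b, s, t, u, v) : rtube_label) (mu ⊠⊠ gamma).

Definition rpart (r : rtube) b s t u v :
    hom (irr s) (irr t ◁ irr b) ⊠ hom (irr u ◁ irr b) (irr v) :=
  dproj ((b, s, t, u, v) : rtube_label) r.

Definition rtube_one : rtube :=
  \sum_s \sum_u
    relt ((idm (irr s) ◁◁ u1) ∘ (runit G (irr s))^†)
         (runit G (irr u) ∘ (idm (irr u) ◁◁ u1^†)).

Definition rtube_mul (r r' : rtube) : rtube :=
  \sum_b \sum_s \sum_t \sum_u \sum_v \sum_b' \sum_t' \sum_u'
  tlift (fun mu gamma => tlift (fun mu' gamma' =>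
    \sum_k \sum_(i < db_size (tD k (bobj (tens (uf_tens D)) (irr b') (irr b))))
      let sigma := tnth (db (tD k _)) i in
      let sigma' := tnth (db' (tD k _)) i in
      relt ((idm (irr t') ◁◁ sigma') ∘ rassoc G (irr t') (irr b') (irr b)
              ∘ (mu' ◁◁ idm (irr b)) ∘ mu)
           (gamma ∘ (gamma' ◁◁ idm (irr b))
              ∘ (rassoc G (irr u') (irr b') (irr b))^†
              ∘ (idm (irr u') ◁◁ sigma)))
    (rpart r' b' t t' u' u)) (rpart r b s t u v).

Definition rtube_counit (r : rtube) : K :=
  \sum_b \sum_s \sum_t
    tlift (E := K^o) (fun mu gamma => scal (gamma ∘ mu)) (rpart r b s t t s).

Definition rtube_comul (r : rtube) : rtube ⊠ rtube :=
  \sum_b \sum_s \sum_t \sum_u \sum_v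
  tlift (fun mu gamma =>
    \sum_i \sum_k \sum_(j < db_size (tM k (irr i ◁ irr b)))
      relt (tnth (db (tM k (irr i ◁ irr b))) j) gamma
        ⊠⊠ relt mu (tnth (db' (tM k (irr i ◁ irr b))) j))
    (rpart r b s t u v).

Definition rtube_antipode (r : rtube) : rtube :=
  \sum_b \sum_s \sum_t \sum_u \sum_v
  tlift (fun mu gamma =>
    (d u / d v) *:
    relt ((gamma ◁◁ idm (irr (bar sD b)))
            ∘ (rassoc G (irr u) (irr b) (irr (bar sD b)))^†
            ∘ (idm (irr u) ◁◁ st_R' sD b) ∘ (runit G (irr u))^†)
         (runit G (irr t) ∘ (idm (irr t) ◁◁ (st_R' sD b)^†)
            ∘ rassoc G (irr t) (irr b) (irr (bar sD b))
            ∘ (mu ◁◁ idm (irr (bar sD b)))))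
    (rpart r b s t u v).

Definition right_tube : wHopfData K :=
  WHopfData rtube_one rtube_mul rtube_counit rtube_comul rtube_antipode.

End RightTube.

(** * The pairing *)

(* Only components with labels [(b; s, t, u, v)] and [(a; t, u, v, s)] pair
   nontrivially. *)
Definition tube_pairing (K : numClosedFieldType) (C D : unitaryFusionCat K)
    (M : semisimpleCat K) (B : bimodule C D M)
    (r : rtube (br B)) (l : ltube (bl B)) : K :=
  \sum_b \sum_s \sum_t \sum_u \sum_v \sum_a
  tlift (E := K^o) (fun mu gamma => tlift (E := K^o) (fun nu zeta =>
    scal (zeta ∘ bhom (lact (bl B)) (idm (irr a)) gamma
            ∘ bmid B (irr a) (irr u) (irr b)
            ∘ bhom (ract (br B)) nu (idm (irr b)) ∘ mu))
    (lpart l a t u v s)) (rpart r b s t u v).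

(* Main.v *)
(** Elements of both tube algebras are sums of pure tensors, so every axiom
  reduces to an identity between composites of morphisms of [M]. For the two
  multiplicativity axioms this is completeness of dual bases together with the
  pentagons of the bimodule category.

  Since both antipodes are bijective, the antipode axiom says that
  [p (S u) (S v) = p u v]. Up to coherence, the left side is the partial trace,
  over [a] on the left and [b] on the right, of the endomorphism [g ∘ h] of
  [a ▷ u ◁ b], where the right side is [h ∘ g]. So one needs the module trace
  property: if [g : n -> a ▷ u] and [h : a ▷ u -> n] with [u], [n] simple, the
  partial trace of [g ∘ h] over [a] is [d n / d u] times the scalar [h ∘ g].

  To prove it, bend the leg [a]: this gives antilinear, mutually inverse maps
  between [Hom(n, a ▷ u)] and [Hom(u, ā ▷ n)]. Let [A], [B] be their matrices
  in orthonormal bases, so that [B * conj A = 1]. The conjugate equations give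
  [sum_n |A|^2 = q] for each [u] and [sum_u |B|^2 = q] for each [n], where [q]
  is the dimension of [a]. Hence the sum over [u], [n] of
  [|d u * A - d n * B^T|^2] is
  [2 q sum_u d u^2 - 2 sum_(u,n) d u d n dim Hom(a ▷ u, n)], which vanishes by
  the defining equation of [d]. So [d u * A = d n * B^T], which is the claim. *)

Require Import Defs.
From mathcomp Require Import all_boot all_order all_algebra.
From mathcomp Require Import complex reals ring.
From HB Require Import structures.

Set Implicit Arguments.
Unset Strict Implicit.
Unset Printing Implicit Defensive.

Import Order.TTheory GRing.Theory Num.Theory.
(* [hom] would otherwise refer to the [hom] of the vector library. *)
Import Defs.
Local Open Scope ring_scope.

(** * Iterated sums with a single nonzero term *)

Section SingleTerm.
Variable E : nmodType.

Lemma sum_only1 (I : finType) (G : I -> E) i0 :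
  (forall i, i != i0 -> G i = 0) -> \sum_i G i = G i0.
Proof. by move=> G0; rewrite (bigD1 i0) //= big1 ?addr0. Qed.

Lemma sum_only3 (I J L : finType) (G : I -> J -> L -> E) i0 j0 l0 :
  (forall i j l, (i, j, l) != (i0, j0, l0) -> G i j l = 0) ->
  \sum_i \sum_j \sum_l G i j l = G i0 j0 l0.
Proof.
move=> G0; rewrite (sum_only1 (i0 := i0)); last first.
  move=> i ni; rewrite big1 // => j _; rewrite big1 // => l _.
  by rewrite G0 // !xpair_eqE (negPf ni).
rewrite (sum_only1 (i0 := j0)); last first.
  by move=> j nj; rewrite big1 // => l _; rewrite G0 // !xpair_eqE (negPf nj) andbF.
by apply: sum_only1 => l nl; rewrite G0 // !xpair_eqE (negPf nl) andbF.
Qed.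

Lemma sum_only5 (I J L N Q : finType) (G : I -> J -> L -> N -> Q -> E)
    i0 j0 l0 n0 q0 :
  (forall i j l n q, (i, j, l, n, q) != (i0, j0, l0, n0, q0) ->
     G i j l n q = 0) ->
  \sum_i \sum_j \sum_l \sum_n \sum_q G i j l n q = G i0 j0 l0 n0 q0.
Proof.
move=> G0; rewrite (sum_only3 (i0 := i0) (j0 := j0) (l0 := l0)); last first.
  move=> i j l ne; rewrite big1 // => n _; rewrite big1 // => q _.
  by rewrite G0 //; apply: contraNneq ne => -[-> -> -> _ _].
rewrite (sum_only1 (i0 := n0)); last first.
  by move=> n nn; rewrite big1 // => q _; rewrite G0 // !xpair_eqE (negPf nn) andbF.
by apply: sum_only1 => q nq; rewrite G0 // !xpair_eqE (negPf nq) andbF.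
Qed.

End SingleTerm.

(** * Linearity of maps on tensors and direct sums in coordinates *)

Section LinearFunctions.
Variable K : fieldType.
Implicit Types A B E : vectType K.

Section Lin.
Variables (A E : lmodType K) (f : A -> E).
Hypothesis fl : linear f.

(** Linearity is a hypothesis here, so these rules apply to anonymous functions such as
    [fun u => p u v] without packing a structure. *)
Lemma lin0 : f 0 = 0.
Proof. by rewrite -[0](subrr (0 : A)) -scaleN1r addrC fl scaleN1r addNr. Qed.

Lemma linD x y : f (x + y) = f x + f y.
Proof. by rewrite -[x in LHS]scale1r fl scale1r. Qed.

Lemma linZ c x : f (c *: x) = c *: f x.
Proof. by rewrite -[c *: x]addr0 fl lin0 addr0. Qed.

Lemma lin_sum I (r : seq I) (P : pred I) (F : I -> A) :
  f (\sum_(i <- r | P i) F i) = \sum_(i <- r | P i) f (F i).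
Proof. exact: (big_morph f linD lin0). Qed.

End Lin.

Lemma linear_bigsum (A E : lmodType K) (I : finType) (f : I -> A -> E) :
  (forall i, linear (f i)) -> linear (fun x => \sum_i f i x).
Proof.
move=> fl c x y; rewrite scaler_sumr -big_split /=.
by apply: eq_bigr => i _; rewrite fl.
Qed.

Lemma linear_o (A B E : lmodType K) (g : B -> E) (f : A -> B) :
  linear g -> linear f -> linear (fun x => g (f x)).
Proof. by move=> gl fl c x y; rewrite fl gl. Qed.

Lemma tlift_linear A B E (f : A -> B -> E) : linear (tlift f).
Proof.
move=> c s t; rewrite /tlift scaler_sumr -big_split /=; apply: eq_bigr => i _.
rewrite scaler_sumr -big_split /=; apply: eq_bigr => j _.
by rewrite !mxE scalerDl scalerA.
Qed.

Lemma tlift_linear_fun (G : lmodType K) A B E (f : G -> A -> B -> E) t :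
  (forall a b, linear (fun g => f g a b)) -> linear (fun g => tlift (f g) t).
Proof.
move=> fl; apply: linear_bigsum => i; apply: linear_bigsum => j c x y.
by rewrite fl scalerDr !scalerA mulrC.
Qed.

Lemma tlift_eq0 A B E (f : A -> B -> E) t :
  (forall a b, f a b = 0) -> tlift f t = 0.
Proof.
by move=> e; rewrite /tlift !big1 // => i _; rewrite big1 // => j _;
  rewrite e scaler0.
Qed.

Lemma tlift_0 A B E (f : A -> B -> E) : tlift f 0 = 0.
Proof. by rewrite lin0 //; apply: tlift_linear. Qed.

Lemma ptens_linl A B (b : B) : linear (fun a : A => ptens a b).
Proof.
move=> c x y; apply/matrixP => i j.
by rewrite !mxE !linearE /= mulrDl mulrA.
Qed.

Lemma ptens_linr A B (a : A) : linear (fun b : B => ptens a b).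
Proof.
move=> c x y; apply/matrixP => i j.
by rewrite !mxE !linearE /= mulrDr mulrCA.
Qed.

Lemma tens_sum A B (t : A ⊠ B) :
  t = \sum_i \sum_j (t : 'M_(_, _)) i j *:
        (tnth (vbasis {:A}) i ⊠⊠ tnth (vbasis {:B}) j).
Proof.
apply/matrixP => i j; pose ent (t : A ⊠ B) : K^o := (t : 'M_(_, _)) i j.
have entl : linear ent by move=> c x y; rewrite /ent !mxE.
rewrite -[LHS]/(ent t) -[RHS]/(ent _) (lin_sum entl) (sum_only1 (i0 := i)).
  rewrite (lin_sum entl) (sum_only1 (i0 := j)) => [|k nk].
    by rewrite /ent !mxE !(tnth_nth 0) !coord_free ?(basis_free (vbasisP _)) //
      !eqxx !mulr1.
  rewrite /ent !mxE !(tnth_nth 0) (coord_free k) ?(basis_free (vbasisP _)) //.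
  by rewrite ?(negPf nk) ?[j == k]eq_sym ?(negPf nk) !mulr0.
move=> k nk; rewrite (lin_sum entl) big1 // => l _.
rewrite /ent !mxE !(tnth_nth 0) coord_free ?(basis_free (vbasisP _)) //.
by rewrite ?(negPf nk) ?[i == k]eq_sym ?(negPf nk) mul0r mulr0.
Qed.

Lemma dinj_linear (L : finType) (T : L -> vectType K) l :
  linear (fun t : T l => dinj t).
Proof.
move=> c x y; apply/ffunP => -[l' j]; rewrite !ffunE /=.
have [e|ne] := eqVneq l l'.
  by case: _ / e j => j; rewrite !dfwith_in linearP.
by rewrite !dfwith_out // linear0 scaler0 addr0.
Qed.

Lemma dproj_linear (L : finType) (T : L -> vectType K) l :
  linear (fun v : dsum T => dproj l v).
Proof.
move=> c x y; rewrite /dproj scaler_sumr -big_split /=.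
by apply: eq_bigr => j _; rewrite !ffunE scalerDl scalerA.
Qed.

Lemma dproj_in (L : finType) (T : L -> vectType K) l (t : T l) :
  dproj l (dinj t) = t.
Proof. by rewrite dproj_dinj dfwith_in. Qed.

Lemma dproj_out (L : finType) (T : L -> vectType K) l (t : T l) l' :
  l' != l -> dproj l' (dinj t) = 0.
Proof. by move=> ne; rewrite dproj_dinj dfwith_out // eq_sym. Qed.

(** Rank-nullity in finite dimension. For the antipodes it is then enough to find preimages of pure
    tensors. *)
Lemma linear_surj_bij A (f : A -> A) :
  linear f -> (forall y, exists x, f x = y) -> bijective f.
Proof.
move=> fl fs; pose fL := GRing.isLinear.Build K A A *:%R f fl.
pose g : {linear A -> A} := HB.pack f fL.
have gE x : linfun g x = f x by rewrite lfunE.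
have img : limg (linfun g) = fullv.
  apply/eqP; rewrite eqEsubv subvf; apply/subvP => y _.
  by have [x <-] := fs y; rewrite -gE memv_img // memvf.
have ker : lker (linfun g) == 0%VS.
  rewrite -dimv_eq0 -(eqn_add2r (\dim {:A})) add0n -{1}img.
  by rewrite -(limg_ker_dim (linfun g) fullv) capfv.
have fK : cancel f (linfun g)^-1%VF by move=> x; rewrite -gE lker0_lfunK.
by exists (linfun g)^-1%VF => // y; have [x <-] := fs y; rewrite fK.
Qed.

End LinearFunctions.

(** * Unitary categories *)

Section UnitaryCategories.
Variables (K : numClosedFieldType) (A : unitaryCat K).
Implicit Types x y z : A.

Lemma comp0m x y z (f : hom x y) : (0 : hom y z) ∘ f = 0.
Proof. exact: (lin0 (@comp_linl _ _ _ _ _ f)). Qed.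
Lemma compm0 x y z (g : hom y z) : g ∘ (0 : hom x y) = 0.
Proof. exact: (lin0 (comp_linr g)). Qed.
Lemma compZl x y z c (g : hom y z) (f : hom x y) : (c *: g) ∘ f = c *: (g ∘ f).
Proof. exact: (linZ (@comp_linl _ _ _ _ _ f)). Qed.
Lemma compZr x y z c (g : hom y z) (f : hom x y) : g ∘ (c *: f) = c *: (g ∘ f).
Proof. exact: (linZ (comp_linr g)). Qed.
Lemma compDl x y z (g g' : hom y z) (f : hom x y) :
  (g + g') ∘ f = g ∘ f + g' ∘ f.
Proof. exact: (linD (@comp_linl _ _ _ _ _ f)). Qed.
Lemma compDr x y z (g : hom y z) (f f' : hom x y) :
  g ∘ (f + f') = g ∘ f + g ∘ f'.
Proof. exact: (linD (comp_linr g)). Qed.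
Lemma compNr x y z (g : hom y z) (f : hom x y) : g ∘ (- f) = - (g ∘ f).
Proof. by rewrite -scaleN1r compZr scaleN1r. Qed.
Lemma comp_suml x y z I (r : seq I) P (g : I -> hom y z) (f : hom x y) :
  (\sum_(i <- r | P i) g i) ∘ f = \sum_(i <- r | P i) g i ∘ f.
Proof. exact: (lin_sum (@comp_linl _ _ _ _ _ f)). Qed.
Lemma comp_sumr x y z I (r : seq I) P (g : hom y z) (f : I -> hom x y) :
  g ∘ (\sum_(i <- r | P i) f i) = \sum_(i <- r | P i) g ∘ f i.
Proof. exact: (lin_sum (comp_linr g)). Qed.

Lemma dag0 x y : (0 : hom x y)^† = 0.
Proof.
by have := dag_antilin (-1) (0 : hom x y) 0; rewrite scaler0 addr0
  rmorphN rmorph1 scaleN1r addNr.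
Qed.
Lemma dagD x y (f g : hom x y) : (f + g)^† = f^† + g^†.
Proof. by rewrite -[f in LHS]scale1r dag_antilin rmorph1 scale1r. Qed.
Lemma dagZ x y c (f : hom x y) : (c *: f)^† = c^* *: f^†.
Proof. by rewrite -[c *: f]addr0 dag_antilin dag0 addr0. Qed.
Lemma dag_sum x y I (r : seq I) P (f : I -> hom x y) :
  (\sum_(i <- r | P i) f i)^† = \sum_(i <- r | P i) (f i)^†.
Proof. exact: (big_morph _ (@dagD x y) (dag0 x y)). Qed.

Lemma unitaryE x y (f : hom x y) : unitary f -> f^† ∘ f = idm x.
Proof. by case. Qed.
Lemma unitaryV x y (f : hom x y) : unitary f -> f ∘ f^† = idm y.
Proof. by case. Qed.
Lemma unitaryKl x y z (f : hom y z) (g : hom x y) :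
  unitary f -> f^† ∘ (f ∘ g) = g.
Proof. by move=> fu; rewrite compA unitaryE // comp1m. Qed.
Lemma unitaryVKl x y z (f : hom y z) (g : hom x z) :
  unitary f -> f ∘ (f^† ∘ g) = g.
Proof. by move=> fu; rewrite compA unitaryV // comp1m. Qed.
Lemma unitaryKr x y z (f : hom x y) (g : hom y z) :
  unitary f -> g ∘ f ∘ f^† = g.
Proof. by move=> fu; rewrite -compA unitaryV // compm1. Qed.
Lemma unitaryVKr x y z (f : hom x y) (g : hom x z) :
  unitary f -> g ∘ f^† ∘ f = g.
Proof. by move=> fu; rewrite -compA unitaryE // compm1. Qed.

Lemma idm_simple_neq0 x : simple x -> idm x != 0.
Proof.
move=> sx; apply/eqP => id0.
suff : \dim {:hom x x} = 0%N by rewrite sx.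
apply/eqP; rewrite dimv_eq0 -subv0; apply/subvP => f _.
by rewrite memv0 -(comp1m f) id0 comp0m.
Qed.

Lemma scalE x (f : hom x x) : simple x -> f = scal f *: idm x.
Proof.
move=> sx; have b : basis_of {:hom x x} [tuple idm x].
  rewrite basisEfree /= seq1_free idm_simple_neq0 // subvf /=.
  by rewrite [\dim _]sx.
by rewrite [LHS](coord_basis b (memvf f)) big_ord1.
Qed.

Lemma scal_linear x : linear (fun f : hom x x => scal f : K^o).
Proof. by move=> c f g; rewrite /scal linearP. Qed.

Lemma scalZ x c (f : hom x x) : scal (c *: f) = c * scal f.
Proof. exact: (linZ (@scal_linear x)). Qed.
Lemma scal_sum x I (r : seq I) P (f : I -> hom x x) :
  scal (\sum_(i <- r | P i) f i) = \sum_(i <- r | P i) scal (f i).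
Proof. exact: (lin_sum (@scal_linear x)). Qed.
Lemma scal0 x : scal (0 : hom x x) = 0.
Proof. exact: (lin0 (@scal_linear x)). Qed.

Lemma scal_id x c : simple x -> scal (c *: idm x) = c.
Proof.
move=> sx; have /eqP := scalE (c *: idm x) sx.
rewrite -subr_eq0 -scalerBl scaler_eq0 (negPf (idm_simple_neq0 sx)) orbF.
by rewrite subr_eq0 => /eqP.
Qed.

Lemma scal_dag x (f : hom x x) : simple x -> scal f^† = (scal f)^*.
Proof.
by move=> sx; rewrite {1}(scalE f sx) dagZ dag_id scal_id.
Qed.

Lemma comp_scall x y (f : hom y y) (g : hom x y) :
  simple y -> f ∘ g = scal f *: g.
Proof. by move=> sy; rewrite {1}(scalE f sy) compZl comp1m. Qed.

Lemma comp_scalr x y (f : hom x x) (g : hom x y) :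
  simple x -> g ∘ f = scal f *: g.
Proof. by move=> sx; rewrite {1}(scalE f sx) compZr compm1. Qed.

(** Schur's lemma: [f^† ∘ f] and [f ∘ f^†] are scalars, the first nonzero by positivity of the
    dagger, so a multiple of [f^†] inverts [f]. *)
Lemma iso_of_neq0 x y (f : hom x y) : simple x -> simple y -> f != 0 -> iso x y.
Proof.
move=> sx sy nf; have nc : scal (f^† ∘ f) != 0.
  apply: contra_neq nf => c0; apply: dag_pos.
  by rewrite (scalE (f^† ∘ f) sx) c0 scale0r.
(* Both scalars are the factor by which [f ∘ f^† ∘ f] differs from [f]. *)
have e : scal (f ∘ f^†) = scal (f^† ∘ f).
  have /eqP := esym (comp_scall (f ∘ f^†) f sy); rewrite -compA (comp_scalr _ _ sx).
  by rewrite -subr_eq0 -scalerBl scaler_eq0 (negPf nf) orbF subr_eq0 => /eqP.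
exists f, ((scal (f^† ∘ f))^-1 *: f^†); rewrite compZl compZr.
by rewrite (scalE (f^† ∘ f) sx) (scalE (f ∘ f^†) sy) e !scalerA !scal_id // mulVf // !scale1r.
Qed.

(* If [c := scal (f^† ∘ f)] were negative, then [(√-c, f) : x -> x ⊕ y] would be
   a nonzero morphism [g] with [g^† ∘ g = 0]. *)
Lemma dag_comp_ge0 x y (f : hom x y) :
  has_direct_sums A -> simple x -> 0 <= scal (f^† ∘ f).
Proof.
move=> hs sx; set c := scal _.
have cr : c \is Num.real.
  by rewrite CrealE /c -scal_dag // dag_comp dagK.
have [//|c0] := real_leP (@real0 K) cr.
have [s [i [i1 i2 _]]] := hs 2 (fun j => if j == ord0 then x else y).
pose ix : hom x s := i ord0.
pose iy : hom y s := i ord_max.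
pose g := sqrtC (- c) *: ix + iy ∘ f.
have ixx : ix^† ∘ ix = idm x := i1 ord0.
have iyy : iy^† ∘ iy = idm y := i1 ord_max.
have ixy : ix^† ∘ iy = 0 by exact: (i2 ord0 ord_max).
have iyx : iy^† ∘ ix = 0 by exact: (i2 ord_max ord0).
have scj : (sqrtC (- c))^* = sqrtC (- c).
  by apply: conj_Creal; rewrite ger0_real // sqrtC_ge0 oppr_ge0 ltW.
have g0 : g = 0.
  apply: dag_pos; rewrite /g dagD dagZ dag_comp !compDl !compDr.
  rewrite !compZl !compZr ixx !compA -(compA _ _ iy) iyy -(compA _ _ ix) iyx.
  rewrite ixy comp0m compm0 !scaler0 addr0 add0r compm1 scalerA.
  rewrite scj -expr2 sqrtCK.
  by rewrite (scalE (f^† ∘ f) sx) -/c -scalerDl addNr scale0r.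
have : ix^† ∘ g = 0 by rewrite g0 compm0.
rewrite /g compDr compZr ixx compA ixy comp0m addr0 => /eqP.
rewrite scaler_eq0 (negPf (idm_simple_neq0 sx)) orbF sqrtC_eq0 oppr_eq0.
by rewrite (lt_eqF c0).
Qed.

Definition orthonormal_family x y n (e : 'I_n -> hom x y) : Prop :=
  forall i j, (e i)^† ∘ e j = (i == j)%:R *: idm x.

(** Gram-Schmidt along the list, for the inner product [scal (f^† ∘ g)]. *)
Lemma orthonormal_basis_span x y (s : seq (hom x y)) :
  has_direct_sums A -> simple x ->
  exists n (e : 'I_n -> hom x y), orthonormal_family e /\
    forall f, f \in s -> f = \sum_i scal ((e i)^† ∘ f) *: e i.
Proof.
move=> hs sx; elim: s => [|v s [n [e [oe se]]]].
  by exists 0%N, (fun=> 0); split=> // -[].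
pose w := v - \sum_i scal ((e i)^† ∘ v) *: e i.
have ew i : (e i)^† ∘ w = 0.
  rewrite /w compDr compNr comp_sumr (bigD1 i) //= big1; last first.
    by move=> j ne; rewrite compZr oe eq_sym (negPf ne) scale0r scaler0.
  by rewrite compZr oe eqxx scale1r addr0 -(scalE _ sx) subrr.
have [w0|nw] := eqVneq w 0.
  exists n, e; split=> // f; rewrite inE => /orP[/eqP->|/se//].
  by apply/eqP; rewrite -subr_eq0 -/w w0.
pose c := scal (w^† ∘ w).
have cp : 0 < c.
  rewrite lt_def dag_comp_ge0 // andbT; apply: contra_neq nw => c0.
  by apply: dag_pos; rewrite (scalE (w^† ∘ w) sx) -/c c0 scale0r.
(* As [c] is positive, its root is real; hence [r] is its own conjugate and [r *: w] is
   normalized. *)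
pose r := (sqrtC c)^-1.
have rr : r^* * r * c = 1.
  rewrite [r^*]conj_Creal ?ger0_real // ?invr_ge0 ?sqrtC_ge0 ?ltW //.
  by rewrite /r -invfM -expr2 sqrtCK mulVf // gt_eqF.
pose e' (i : 'I_n.+1) := if unlift ord0 i is Some j then e j else r *: w.
have e'0 : e' ord0 = r *: w by rewrite /e' unlift_none.
have e'S j : e' (lift ord0 j) = e j by rewrite /e' liftK.
have we i : w^† ∘ e i = 0 by rewrite -[LHS]dagK dag_comp dagK ew dag0.
exists n.+1, e'; split=> [i j|f].
  case: (unliftP ord0 i) => [i' ->|->]; case: (unliftP ord0 j) => [j' ->|->].
  - by rewrite !e'S oe (inj_eq lift_inj).
  - by rewrite e'S e'0 compZr ew scaler0 eq_sym (negPf (neq_lift _ _)) scale0r.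
  - by rewrite e'S e'0 dagZ compZl we scaler0 (negPf (neq_lift _ _)) scale0r.
  - by rewrite e'0 dagZ compZl compZr !scalerA (scalE (w^† ∘ w) sx) -/c
      scalerA rr eqxx.
rewrite inE => fs; rewrite big_ord_recl e'0 (eq_bigr (fun i =>
  scal ((e i)^† ∘ f) *: e i)); last by move=> i _; rewrite e'S.
(* For [v] the new coordinate restores exactly [w]; for the earlier vectors it vanishes, since [w]
   is orthogonal to the old family. *)
case/orP: fs => [/eqP->|/[dup] fs /se fE].
  have vE : v = w + \sum_i scal ((e i)^† ∘ v) *: e i by rewrite /w subrK.
  have wv : w^† ∘ v = w^† ∘ w.
    rewrite {1}vE compDr comp_sumr big1 ?addr0 // => i _.
    by rewrite compZr we scaler0.
  by rewrite dagZ compZl scalZ wv -/c scalerA mulrAC rr scale1r -vE.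
rewrite {2}fE comp_sumr big1 ?scal0 ?scale0r ?add0r // => i _.
by rewrite compZr dagZ compZl we !scaler0.
Qed.

Lemma orthonormal_basis_ex x y :
  has_direct_sums A -> simple x ->
  exists n (e : 'I_n -> hom x y), orthonormal_family e /\
    forall f, f = \sum_i scal ((e i)^† ∘ f) *: e i.
Proof.
move=> hs sx.
have [n [e [oe se]]] := orthonormal_basis_span (vbasis {:hom x y}) hs sx.
exists n, e; split=> // f.
(* Written as composition with a projector, the expansion is linear in [f], so it may be checked on
   the vectors of [vbasis]. *)
have <- : (\sum_i e i ∘ (e i)^†) ∘ f = \sum_i scal ((e i)^† ∘ f) *: e i.
  by rewrite comp_suml; apply: eq_bigr => i _; rewrite -compA (comp_scalr _ _ sx).
rewrite [f](coord_vbasis (memvf f)) comp_sumr; apply: eq_bigr => i _.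
rewrite compZr; congr (_ *: _); rewrite {1}[_`_i]se ?mem_nth ?size_tuple //.
by rewrite comp_suml; apply: eq_bigr => j _; rewrite -compA (comp_scalr _ _ sx).
Qed.

Lemma orthonormal_free x y n (e : 'I_n -> hom x y) (c : 'I_n -> K) i :
  simple x -> orthonormal_family e -> scal ((e i)^† ∘ \sum_j c j *: e j) = c i.
Proof.
move=> sx oe; rewrite comp_sumr (sum_only1 (i0 := i)) => [|j nj].
  by rewrite compZr oe eqxx scale1r scal_id.
by rewrite compZr oe eq_sym (negPf nj) scale0r scaler0.
Qed.

(** Lets the multiplicities in the defining equation of [d] be read as numbers of basis vectors. *)
Lemma orthonormal_card x y n (e : 'I_n -> hom x y) : simple x ->
  orthonormal_family e -> (forall f, f = \sum_i scal ((e i)^† ∘ f) *: e i) ->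
  \dim {:hom x y} = n.
Proof.
move=> sx oe se; pose t := [tuple e i | i < n].
have tE (i : 'I_n) : t`_i = e i by rewrite -tnth_nth tnth_mktuple.
suff b : basis_of {:hom x y} t by rewrite -(size_basis b).
rewrite basisEdim; apply/andP; split.
  apply/subvP => f _; rewrite (se f); apply: memv_suml => i _.
  by rewrite memvZ // memv_span // -(tE i) mem_nth // size_tuple.
suff /eqP <- : free t by apply: dimvS; apply: subvf.
apply/freeP => c c0 i; rewrite -(orthonormal_free c i sx oe).
under eq_bigr => j _ do rewrite -tE.
by rewrite c0 compm0 scal0.
Qed.

End UnitaryCategories.

(** * Completeness of bases in semisimple categories *)

Section Semisimple.
Variables (K : numClosedFieldType) (A : semisimpleCat K).

Lemma hom_irr0 (k k' : Irr A) (f : hom (irr k) (irr k')) : k != k' -> f = 0.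
Proof.
move=> ne; apply/eqP; apply: contraNT ne => nf; apply/eqP; apply: irr_inj.
exact: iso_of_neq0 (irr_simple k) (irr_simple k') nf.
Qed.

(** Insert the decomposition of [idm X] into simple summands; each inclusion factors through an
    isomorphic representative in [Irr A]. *)
Lemma hom_from_irr_ext (X Y : A) (f g : hom X Y) :
  (forall (k : Irr A) (e : hom (irr k) X), f ∘ e = g ∘ e) -> f = g.
Proof.
move=> fg; have [n [k [sk [i [_ _ idX]]]]] := ss_semisimple X.
rewrite -(compm1 f) -(compm1 g) -idX !comp_sumr; apply: eq_bigr => j _.
have [l [a [b [ba _]]]] := irr_all (Irr A) (sk j).
by rewrite -[i j]compm1 -ba !compA -(compA f) -(compA g) fg.
Qed.

Lemma dual_basis_expand (x Y : A) (b : dual_bases x Y) (f : hom x Y) :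
  simple x -> \sum_(j < db_size b) scal (tnth (db' b) j ∘ f) *: tnth (db b) j = f.
Proof.
move=> sx; have [c ->] : exists c : 'I_(db_size b) -> K,
    f = \sum_j c j *: tnth (db b) j.
  exists (fun j => coord (db b) j f).
  rewrite [LHS](coord_basis (db_basis b) (memvf f)).
  by apply: eq_bigr => j _; rewrite (tnth_nth 0).
apply: eq_bigr => j _; congr (_ *: _).
rewrite comp_sumr (sum_only1 (i0 := j)) => [|l nl].
  by rewrite compZr db_dual eqxx scale1r scal_id.
by rewrite compZr db_dual eq_sym (negPf nl) scale0r scaler0.
Qed.

Lemma dual_basis_expand' (x Y : A) (b : dual_bases x Y) (f : hom Y x) :
  simple x -> \sum_(j < db_size b) scal (f ∘ tnth (db b) j) *: tnth (db' b) j = f.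
Proof.
move=> sx; have [c ->] : exists c : 'I_(db_size b) -> K,
    f = \sum_j c j *: tnth (db' b) j.
  exists (fun j => coord (db' b) j f).
  rewrite [LHS](coord_basis (db'_basis b) (memvf f)).
  by apply: eq_bigr => j _; rewrite (tnth_nth 0).
apply: eq_bigr => j _; congr (_ *: _).
rewrite comp_suml (sum_only1 (i0 := j)) => [|l nl].
  by rewrite compZl db_dual eqxx scale1r scal_id.
by rewrite compZl db_dual (negPf nl) scale0r scaler0.
Qed.

(** Tested on a morphism [f] from [irr k]: by Schur's lemma only the summand of that same [k]
    survives, and it is the expansion of [f]. *)
Lemma dual_bases_complete (t : dual_bases_system A) (Y : A) :
  \sum_k \sum_(j < db_size (t k Y)) tnth (db (t k Y)) j ∘ tnth (db' (t k Y)) j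
    = idm Y.
Proof.
apply: hom_from_irr_ext => k f; rewrite comp_suml comp1m.
rewrite (sum_only1 (i0 := k)) => [|k' ne].
  rewrite -[RHS](dual_basis_expand (t k Y) f (irr_simple k)) comp_suml.
  apply: eq_bigr => j _; rewrite -compA; exact: comp_scalr (irr_simple k).
rewrite comp_suml big1 // => j _.
by rewrite -compA (hom_irr0 (_ ∘ f)) ?compm0 // eq_sym.
Qed.

(** The equations for [d] count morphisms out of [a ▷ u], while the orthonormal bases consist of
    morphisms into it; this passes from one to the other. *)
Lemma dual_bases_dim (x Y : A) (b : dual_bases x Y) :
  \dim {:hom Y x} = \dim {:hom x Y}.
Proof.
by rewrite (size_basis (db_basis b)) (size_basis (db'_basis b)).
Qed.

(** The size is packed with the vectors, so that bases for all pairs of simple objects can be chosen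
    as one finite family. *)
Definition orthonormal_basis (x Y : A) (e : {n : nat & 'I_n -> hom x Y}) : Prop :=
  orthonormal_family (projT2 e) /\
  forall f, f = \sum_i scal ((projT2 e i)^† ∘ f) *: projT2 e i.

Lemma orthonormal_basis_exists (x Y : A) :
  simple x -> exists e, @orthonormal_basis x Y e.
Proof.
move=> sx; have [n [e eP]] := orthonormal_basis_ex Y (@ss_sums _ A) sx.
by exists (existT (fun n => 'I_n -> hom x Y) n e).
Qed.

Lemma orthonormal_bases_complete (Y : A)
    (e : forall k : Irr A, {n : nat & 'I_n -> hom (irr k) Y}) :
  (forall k, orthonormal_basis (e k)) ->
  \sum_k \sum_i projT2 (e k) i ∘ (projT2 (e k) i)^† = idm Y.
Proof.
move=> eP; apply: hom_from_irr_ext => k f; rewrite comp_suml comp1m.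
rewrite (sum_only1 (i0 := k)) => [|k' ne].
  rewrite [RHS](eP k).2 comp_suml.
  apply: eq_bigr => j _; rewrite -compA; exact: comp_scalr (irr_simple k).
rewrite comp_suml big1 // => j _.
by rewrite -compA (hom_irr0 (_ ∘ f)) ?compm0 // eq_sym.
Qed.

Lemma parseval (x Y : A) (e : {n : nat & 'I_n -> hom x Y}) (f g : hom x Y) :
  simple x -> orthonormal_basis e ->
  scal (f^† ∘ g) =
    \sum_i (scal ((projT2 e i)^† ∘ f))^* * scal ((projT2 e i)^† ∘ g).
Proof.
move=> sx [oe se]; rewrite {1}(se g) comp_sumr scal_sum; apply: eq_bigr => i _.
by rewrite compZr scalZ mulrC -scal_dag // dag_comp dagK.
Qed.

End Semisimple.

(** * The module trace *)

(** A linear dagger endofunctor. Both [a ▷ -] and [- ◁ b] are instances, so the module trace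
    property is proved once for the two sides. *)
Record dagEndo (K : numClosedFieldType) (A : unitaryCat K) := DagEndo {
  eobj :> A -> A;
  ehom : forall x y, hom x y -> hom (eobj x) (eobj y);
  ehom_linear : forall x y, linear (@ehom x y);
  ehom_id : forall x, ehom (idm x) = idm (eobj x);
  ehom_comp : forall x y z (g : hom y z) (f : hom x y),
    ehom (g ∘ f) = ehom g ∘ ehom f;
  ehom_dag : forall x y (f : hom x y), ehom f^† = (ehom f)^† }.

Section ModuleTrace.
Variables (K : numClosedFieldType) (M : semisimpleCat K) (F F' : dagEndo M).
(** In the applications [F] is the action of a simple object, [F'] that of its dual, and [eta],
    [eta'] come from a standard solution of the conjugate equations, of which [zigzag] is one. *)
Variables (eta : forall u, hom u (F' (F u))) (eta' : forall n, hom n (F (F' n))).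
Hypothesis eta'_nat : forall x y (f : hom x y),
  ehom F (ehom F' f) ∘ eta' x = eta' y ∘ f.
Hypothesis zigzag : forall u, ehom F (eta u)^† ∘ eta' (F u) = idm (F u).
Variables (q : K) (d : Irr M -> K) (tM : dual_bases_system M).
Hypothesis eta_dim : forall u, (eta u)^† ∘ eta u = q *: idm u.
Hypothesis eta'_dim : forall n, (eta' n)^† ∘ eta' n = q *: idm n.
Hypothesis d_gt0 : forall m, 0 < d m.
Hypothesis d_dim : forall m,
  q * d m = \sum_n (\dim {:hom (F (irr m)) (irr n)})%:R * d n.

Section Bases.
Variable e : forall u n : Irr M, {N : nat & 'I_N -> hom (irr n) (F (irr u))}.
Variable f : forall u n : Irr M, {N : nat & 'I_N -> hom (irr u) (F' (irr n))}.
Hypothesis eP : forall u n, orthonormal_basis (e u n).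
Hypothesis fP : forall u n, orthonormal_basis (f u n).
Implicit Types u n : Irr M.

Local Notation E u n i := (projT2 (e u n) i).
Local Notation G u n j := (projT2 (f u n) j).
(** [Es] and [Gs] are the basis vectors with the leg of [F] bent; [a] and [b] are the matrices of
    the two bending maps. The indices of [b] come in the order of those of [a], so the transpose is
    built in. *)
Local Notation Es u n i := (ehom F' (E u n i)^† ∘ eta (irr u)).
Local Notation Gs u n j := (ehom F (G u n j)^† ∘ eta' (irr n)).
Local Notation a u n i j := (scal ((G u n j)^† ∘ Es u n i)).
Local Notation b u n i j := (scal ((E u n i)^† ∘ Gs u n j)).

(** By Parseval the sum is the total squared norm of the bent vectors [Es]; completeness of the [E]
    turns this into [(eta u)^† ∘ eta u]. *)
Let sumA u : \sum_n \sum_i \sum_j (a u n i j)^* * a u n i j = q.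
Proof.
transitivity (scal ((eta (irr u))^† ∘ ehom F' (idm (F (irr u))) ∘ eta (irr u))).
  rewrite -(orthonormal_bases_complete (e := fun n => e u n)); last first.
    by move=> n; apply: eP u n.
  rewrite (lin_sum (@ehom_linear _ _ F' _ _)) comp_sumr comp_suml scal_sum.
  apply: eq_bigr => n _.
  rewrite (lin_sum (@ehom_linear _ _ F' _ _)) comp_sumr comp_suml scal_sum.
  apply: eq_bigr => i _; rewrite ehom_comp.
  rewrite -(parseval (Es u n i) (Es u n i) (irr_simple u) (fP u n)).
  by rewrite dag_comp ehom_dag dagK !compA.
by rewrite ehom_id compm1 eta_dim scal_id //; apply: irr_simple.
Qed.

Let sumB n : \sum_u \sum_j \sum_i (b u n i j)^* * b u n i j = q.
Proof.
transitivity (scal ((eta' (irr n))^† ∘ ehom F (idm (F' (irr n))) ∘ eta' (irr n))).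
  rewrite -(orthonormal_bases_complete (e := fun u => f u n)); last first.
    by move=> u; apply: fP u n.
  rewrite (lin_sum (@ehom_linear _ _ F _ _)) comp_sumr comp_suml scal_sum.
  apply: eq_bigr => u _.
  rewrite (lin_sum (@ehom_linear _ _ F _ _)) comp_sumr comp_suml scal_sum.
  apply: eq_bigr => i _; rewrite ehom_comp.
  rewrite -(parseval (Gs u n i) (Gs u n i) (irr_simple n) (eP u n)).
  by rewrite dag_comp ehom_dag dagK !compA.
by rewrite ehom_id compm1 eta'_dim scal_id //; apply: irr_simple.
Qed.

(** Bending twice is the identity, by naturality of [eta'] and [zigzag]. Expanding the once bent
    vector in the basis [G] gives the product of the two matrices. *)
Let sumAB u n i k : \sum_j (a u n i j)^* * b u n k j = (k == i)%:R.
Proof.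
transitivity (scal ((E u n k)^† ∘ E u n i)); last first.
  by rewrite (eP u n).1 scal_id //; apply: irr_simple.
rewrite [in RHS](_ : E u n i = ehom F (Es u n i)^† ∘ eta' (irr n)); last first.
  by rewrite dag_comp ehom_dag dagK ehom_comp -compA eta'_nat compA zigzag comp1m.
rewrite [in RHS]((fP u n).2 (Es u n i)).
rewrite dag_sum (lin_sum (@ehom_linear _ _ F _ _)).
rewrite comp_suml comp_sumr scal_sum; apply: eq_bigr => j _.
by rewrite dagZ (linZ (@ehom_linear _ _ F _ _)) compZl compZr scalZ.
Qed.

Let card_basis u n :
  \dim {:hom (F (irr u)) (irr n)} = projT1 (e u n).
Proof.
rewrite (dual_bases_dim (tM n (F (irr u)))).
exact: orthonormal_card (irr_simple n) (eP u n).1 (eP u n).2.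
Qed.

Let d_real u : (d u)^* = d u.
Proof. by apply: conj_Creal; rewrite gtr0_real. Qed.

Let dev u n i j : K := d u * a u n i j - d n * b u n i j.

(** Expansion of a squared norm. Each cross term is the trace of the identity matrix of [sumAB],
    that is the dimension of the hom space. *)
Let sum_dev u n : \sum_i \sum_j (@dev u n i j)^* * @dev u n i j =
  d u ^+ 2 * (\sum_i \sum_j (a u n i j)^* * a u n i j)
  + d n ^+ 2 * (\sum_j \sum_i (b u n i j)^* * b u n i j)
  - 2 * (d u * ((\dim {:hom (F (irr u)) (irr n)})%:R * d n)).
Proof.
have AB : \sum_i \sum_j (a u n i j)^* * b u n i j = (projT1 (e u n))%:R.
  under eq_bigr => i _ do rewrite sumAB eqxx.
  by rewrite sumr_const card_ord.
have BA : \sum_i \sum_j (b u n i j)^* * a u n i j = (projT1 (e u n))%:R.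
  (* The other cross term is the conjugate of [AB], which is a natural number. *)
  rewrite -[RHS]conjC_nat -AB rmorph_sum; apply: eq_bigr => i _.
  rewrite rmorph_sum; apply: eq_bigr => j _.
  by rewrite rmorphM /= conjCK mulrC.
rewrite card_basis [X in _ + _ * X]exchange_big /=.
have -> : 2 * (d u * ((projT1 (e u n))%:R * d n)) =
   d u * d n * (projT1 (e u n))%:R + d u * d n * (projT1 (e u n))%:R.
  by rewrite mulr_natl mulr2n -!mulrA ![d n * _]mulrC.
rewrite -{1}AB -BA opprD.
rewrite !mulr_sumr -!sumrN -!big_split /=; apply: eq_bigr => i _.
rewrite !mulr_sumr -!sumrN -!big_split /=; apply: eq_bigr => j _.
by rewrite /dev rmorphB !rmorphM /= !d_real; ring.
Qed.

(** All squared norms together sum to zero, and none of them is negative. *)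
Let dev_eq0 u n i j : @dev u n i j = 0.
Proof.
have sq_ge0 (x : K) : 0 <= x^* * x by rewrite mulrC mul_conjC_ge0.
have row_ge0 u' n' i' : 0 <= \sum_j (@dev u' n' i' j)^* * @dev u' n' i' j.
  by apply: sumr_ge0.
have blk_ge0 u' n' : 0 <= \sum_i \sum_j (@dev u' n' i j)^* * @dev u' n' i j.
  by apply: sumr_ge0.
have /eqP : \sum_u \sum_n \sum_i \sum_j (@dev u n i j)^* * @dev u n i j = 0.
  (* [sumA] and [sumB] each contribute [q] times the sum of the squares of [d]; by [d_dim] the cross
     terms subtract twice that amount. *)
  under eq_bigr => u' _ do under eq_bigr => n' _ do rewrite sum_dev.
  under eq_bigr => u' _ do rewrite !big_split /= -mulr_sumr sumA sumrN -!mulr_sumr.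
  rewrite !big_split /= [X in _ + X + _]exchange_big /=.
  under [X in _ + X + _]eq_bigr => n' _ do rewrite -mulr_sumr sumB.
  rewrite sumrN -mulr_sumr.
  under [X in _ - _ * X]eq_bigr => u' _ do
    rewrite -d_dim mulrCA -expr2 mulrC.
  by rewrite mulr_natl mulr2n opprD addrA addrK subrr.
have sum0 (I : finType) (x : I -> K) i0 :
    \sum_i x i == 0 -> (forall i, 0 <= x i) -> x i0 == 0.
  move=> /[swap] x_ge0; rewrite psumr_eq0 // => /allP/(_ i0 (mem_index_enum i0)).
  by [].
move=> /(sum0 _ _ u); move=> /(_ (fun u' => sumr_ge0 _ (fun n' _ => blk_ge0 u' n'))).
move=> /(sum0 _ _ n)/(_ (blk_ge0 u)).
move=> /(sum0 _ _ i)/(_ (@row_ge0 u n)).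
move=> /(sum0 _ _ j)/(_ (fun=> sq_ge0 _)).
by rewrite mulf_eq0 conjC_eq0 orbb => /eqP.
Qed.

(** Both sides are sesquilinear in [g] and [h^†], so basis vectors suffice. There the left side is
    [d u] times the inner product of two bent vectors; [dev_eq0] replaces [d u * a] by [d n * b],
    and [sumAB] evaluates the result. *)
Lemma module_trace_bases u n (g : hom (irr n) (F (irr u)))
    (h : hom (F (irr u)) (irr n)) :
  d u * scal ((eta (irr u))^† ∘ ehom F' (g ∘ h) ∘ eta (irr u))
    = d n * scal (h ∘ g).
Proof.
(* From here on [h] stands for its dagger, so that it expands in the same basis as [g]. *)
rewrite -[h]dagK; move: h^† => {}h.
pose c i := scal ((E u n i)^† ∘ g).
pose c' i := scal ((E u n i)^† ∘ h).
have -> : g = \sum_i c i *: E u n i := (eP u n).2 g.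
have -> : h = \sum_i c' i *: E u n i := (eP u n).2 h.
transitivity (\sum_i \sum_k c i * (c' k)^* * ((i == k)%:R * d n)).
  rewrite dag_sum comp_suml (lin_sum (@ehom_linear _ _ F' _ _)).
  rewrite comp_sumr comp_suml scal_sum mulr_sumr; apply: eq_bigr => i _.
  rewrite comp_sumr (lin_sum (@ehom_linear _ _ F' _ _)).
  rewrite comp_sumr comp_suml scal_sum mulr_sumr; apply: eq_bigr => k _.
  rewrite dagZ compZl compZr scalerA (linZ (@ehom_linear _ _ F' _ _)).
  rewrite compZr compZl scalZ mulrCA; congr (_ * _).
  transitivity (d u * scal ((Es u n i)^† ∘ Es u n k)).
    by rewrite dag_comp ehom_dag dagK ehom_comp !compA.
  rewrite (parseval _ _ (irr_simple u) (fP u n)) mulr_sumr.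
  rewrite eq_sym -sumAB mulr_suml; apply: eq_bigr => j _.
  rewrite mulrCA -mulrA; congr (_ * _).
  by rewrite [RHS]mulrC; apply/eqP; rewrite -subr_eq0; apply/eqP/dev_eq0.
rewrite exchange_big dag_sum comp_suml scal_sum mulr_sumr /=.
apply: eq_bigr => k _; rewrite comp_sumr scal_sum mulr_sumr.
apply: eq_bigr => i _; rewrite dagZ compZl compZr scalerA scalZ.
rewrite (eP u n).1 scal_id; last exact: irr_simple.
by rewrite eq_sym [RHS]mulrC [c i * _]mulrC -!mulrA.
Qed.

End Bases.

Lemma module_trace u n (g : hom (irr n) (F (irr u)))
    (h : hom (F (irr u)) (irr n)) :
  d u * scal ((eta (irr u))^† ∘ ehom F' (g ∘ h) ∘ eta (irr u))
    = d n * scal (h ∘ g).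
Proof.
(* Bases are needed for all pairs, not only for [u] and [n], because the vanishing in [dev_eq0]
   comes from the sum over all of them. *)
have /fin_all_exists[e eP] : forall u : Irr M,
  exists e : forall n : Irr M, {N : nat & 'I_N -> hom (irr n) (F (irr u))},
    forall n, orthonormal_basis (e n).
  move=> u'; apply: (fin_all_exists (P := fun n' e => orthonormal_basis e)) => n'.
  exact: orthonormal_basis_exists (irr_simple n').
have /fin_all_exists[f fP] : forall u : Irr M,
  exists f : forall n : Irr M, {N : nat & 'I_N -> hom (irr u) (F' (irr n))},
    forall n, orthonormal_basis (f n).
  move=> u'; apply: (fin_all_exists (P := fun n' e => orthonormal_basis e)) => n'.
  exact: orthonormal_basis_exists (irr_simple u').
exact: module_trace_bases eP fP _ _ _ _.
Qed.

End ModuleTrace.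

(** * Coherence in module and bimodule categories *)

Section Compositions.
Variables (K : numClosedFieldType) (A : unitaryCat K).
Implicit Types x y z t : A.

Lemma comp_rw x y y' z t (g : hom y z) (f : hom x y) (g' : hom y' z)
    (f' : hom x y') (h : hom t x) :
  g ∘ f = g' ∘ f' -> g ∘ (f ∘ h) = g' ∘ (f' ∘ h).
Proof. by move=> e; rewrite !compA e. Qed.

Lemma comp_rw1 x y z t (g : hom y z) (f : hom x y) (g' : hom x z)
    (h : hom t x) :
  g ∘ f = g' -> g ∘ (f ∘ h) = g' ∘ h.
Proof. by move=> e; rewrite !compA e. Qed.

Lemma unitary_injl x y z (u : hom y z) (f g : hom x y) :
  unitary u -> u ∘ f = u ∘ g -> f = g.
Proof. by move=> uu e; rewrite -(unitaryKl f uu) e unitaryKl. Qed.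

Lemma unitary_injr x y z (u : hom x y) (f g : hom y z) :
  unitary u -> f ∘ u = g ∘ u -> f = g.
Proof. by move=> uu e; rewrite -(unitaryKr f uu) e unitaryKr. Qed.

Lemma unitary_move x y z (u : hom x y) (f : hom y z) (g : hom x z) :
  unitary u -> f ∘ u = g -> f = g ∘ u^†.
Proof. by move=> uu <-; rewrite unitaryKr. Qed.

End Compositions.

Section Bifunctors.
Variables (K : numClosedFieldType) (A B E : unitaryCat K) (F : bifunctor A B E).

Lemma bhom_l_comp a a' a'' b (f' : hom a' a'') (f : hom a a') :
  bhom F (f' ∘ f) (idm b) = bhom F f' (idm b) ∘ bhom F f (idm b).
Proof. by rewrite -bhom_comp comp1m. Qed.

Lemma bhom_r_comp a b b' b'' (g' : hom b' b'') (g : hom b b') :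
  bhom F (idm a) (g' ∘ g) = bhom F (idm a) g' ∘ bhom F (idm a) g.
Proof. by rewrite -bhom_comp comp1m. Qed.

Lemma bhom_exchange a a' b b' (f : hom a a') (g : hom b b') :
  bhom F f (idm b') ∘ bhom F (idm a) g = bhom F (idm a') g ∘ bhom F f (idm b).
Proof. by rewrite -!bhom_comp !comp1m !compm1. Qed.

Lemma bhom_unitary a a' b b' (f : hom a a') (g : hom b b') :
  unitary f -> unitary g -> unitary (bhom F f g).
Proof.
by move=> [f1 f2] [g1 g2]; split; rewrite bhom_dag -bhom_comp ?f1 ?f2 ?g1 ?g2 bhom_id.
Qed.

Lemma unitary_id (x : A) : unitary (idm x).
Proof. by split; rewrite dag_id comp1m. Qed.

Definition act_left (a : A) (F' : bifunctor A E E) : dagEndo E.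
Proof.
refine (@DagEndo _ _ (fun m => bobj F' a m) (fun x y f => bhom F' (idm a) f) _ _ _ _).
- by move=> x y; apply: bhom_linr.
- by move=> x; apply: bhom_id.
- by move=> x y z g f; rewrite -bhom_comp comp1m.
- by move=> x y f; rewrite bhom_dag dag_id.
Defined.

Definition act_right (a : A) (F' : bifunctor E A E) : dagEndo E.
Proof.
refine (@DagEndo _ _ (fun m => bobj F' m a) (fun x y f => bhom F' f (idm a)) _ _ _ _).
- by move=> x y; apply: bhom_linl.
- by move=> x; apply: bhom_id.
- by move=> x y z g f; rewrite -bhom_comp comp1m.
- by move=> x y f; rewrite bhom_dag dag_id.
Defined.

End Bifunctors.

(* The coevaluations are locked: otherwise reassociating a composite by
   rewriting unfolds them. *)
Fact coev_key : unit. Proof. exact: tt. Qed.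

(** * Coevaluations for a left module category *)

Section LeftModules.
Variables (K : numClosedFieldType) (A M : unitaryCat K) (T : tensorStr A).
Variable L : leftModule T M.
Local Notation "a ⊗ b" := (bobj (tens T) a b).
Local Notation "f ⊗⊗ g" := (bhom (tens T) f g).
Local Notation "a ▷ m" := (bobj (lact L) a m).
Local Notation "f ▷▷ g" := (bhom (lact L) f g).
Local Notation α := (lassoc L).
Local Notation l := (lunit L).
Local Notation one := (tone T).
Let ax := lact_axioms L.
Let tax := tens_axioms T.

(** By naturality the invertible unitor conjugates [idm one ▷▷ f] to [f]. *)
Lemma lunit_act_inj x y (f g : hom x y) :
  idm one ▷▷ f = idm one ▷▷ g -> f = g.
Proof.
move=> e; apply: (unitary_injr (lm_unit_unitary ax x)).
by rewrite !(lm_unit_nat ax) e.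
Qed.

(* Kelly's argument: not among the axioms, but implied by them. *)
Lemma lunit_act a m : l (a ▷ m) ∘ α one a m = tlunit T a ▷▷ idm m.
Proof.
apply: lunit_act_inj.
apply: (unitary_injr (lm_assoc_unitary ax one (one ⊗ a) m)).
apply: (unitary_injr (bhom_unitary (lact L)
  (ta_assoc_unitary tax one one a) (unitary_id m))).
transitivity ((idm one ▷▷ l (a ▷ m)) ∘ (α one one (a ▷ m) ∘ α (one ⊗ one) a m)).
  by rewrite -(lm_pentagon ax) bhom_r_comp !compA.
rewrite compA (lm_triangle ax) -(bhom_id (lact L) a m) (lm_assoc_nat ax).
rewrite -(ta_triangle tax) bhom_l_comp compA.
by rewrite (lm_assoc_nat ax).
Qed.

Lemma lunit_act_dag a m : (α one a m)^† ∘ (l (a ▷ m))^† = (tlunit T a)^† ▷▷ idm m.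
Proof. by rewrite -dag_comp lunit_act bhom_dag dag_id. Qed.

Lemma lunit_nat_dag x y (f : hom x y) :
  (idm one ▷▷ f) ∘ (l x)^† = (l y)^† ∘ f.
Proof.
rewrite -[LHS]dagK dag_comp dagK bhom_dag dag_id.
by rewrite -(lm_unit_nat ax) dag_comp dagK.
Qed.

(** When [R] belongs to a solution of the conjugate equations, this is the unit of the adjunction
    between [a ▷ -] and [a' ▷ -]; it bends the leg [a]. *)
Definition lcoev a a' (R : hom one (a' ⊗ a)) u : hom u (a' ▷ (a ▷ u)) :=
  locked_with coev_key (α a' a u ∘ (R ▷▷ idm u) ∘ (l u)^†).

Lemma lcoevE a a' (R : hom one (a' ⊗ a)) u :
  lcoev R u = α a' a u ∘ (R ▷▷ idm u) ∘ (l u)^†.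
Proof. by rewrite /lcoev unlock. Qed.

Lemma lcoev_nat a a' (R : hom one (a' ⊗ a)) x y (f : hom x y) :
  (idm a' ▷▷ (idm a ▷▷ f)) ∘ lcoev R x = lcoev R y ∘ f.
Proof.
rewrite !lcoevE !compA (lm_assoc_nat ax) bhom_id -!compA.
by rewrite (comp_rw _ (esym (bhom_exchange _ R f))) lunit_nat_dag.
Qed.

Lemma lcoev_dim a a' (R : hom one (a' ⊗ a)) q u :
  R^† ∘ R = q *: idm one -> (lcoev R u)^† ∘ lcoev R u = q *: idm u.
Proof.
move=> Rq; rewrite !lcoevE !dag_comp dagK -!compA (unitaryKl _ (lm_assoc_unitary ax _ _ _)).
rewrite (compA (_ ▷▷ _)^†) bhom_dag dag_id -bhom_l_comp Rq.
rewrite (linZ (bhom_linl _ _)) bhom_id compZl comp1m compZr.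
by rewrite (unitaryV (lm_unit_unitary ax u)).
Qed.

(** Pentagon, naturality and the unit laws move every associator and unitor into the tensor
    category; what acts on [u] is then the dagger of the first conjugate equation. *)
Lemma lcoev_zigzag a a' (R : hom one (a' ⊗ a)) (R' : hom one (a ⊗ a')) u :
  conjugate_eqs R R' -> (idm a ▷▷ (lcoev R u)^†) ∘ lcoev R' (a ▷ u) = idm (a ▷ u).
Proof.
move=> [zig _]; rewrite !lcoevE !dag_comp dagK !bhom_r_comp -!compA.
have pent : (idm a ▷▷ (α a' a u)^†) ∘ α a a' (a ▷ u) =
    α a (a' ⊗ a) u ∘ ((tassoc T a a' a ▷▷ idm u) ∘ (α (a ⊗ a') a u)^†).
  rewrite compA; apply: (unitary_move (lm_assoc_unitary ax _ _ _)).
  rewrite -compA -(lm_pentagon ax) !compA -bhom_r_comp.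
  by rewrite (unitaryE (lm_assoc_unitary ax _ _ _)) bhom_id comp1m.
rewrite (comp_rw _ pent) -!compA.
have nat : (α (a ⊗ a') a u)^† ∘ (R' ▷▷ idm (a ▷ u)) =
   ((R' ⊗⊗ idm a) ▷▷ idm u) ∘ (α one a u)^†.
  rewrite -(bhom_id (lact L)); apply: (unitary_move (lm_assoc_unitary ax _ _ _)).
  rewrite -compA (lm_assoc_nat ax).
  exact: unitaryKl (lm_assoc_unitary ax _ _ _).
rewrite (comp_rw _ nat) lunit_act_dag.
have nat' : (idm a ▷▷ (R ▷▷ idm u)^†) ∘ α a (a' ⊗ a) u =
   α a one u ∘ ((idm a ⊗⊗ R^†) ▷▷ idm u).
  by rewrite bhom_dag dag_id (lm_assoc_nat ax).
rewrite (comp_rw _ nat') (comp_rw1 _ (lm_triangle ax _ _)) -!bhom_l_comp.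
rewrite -(bhom_id (lact L) a u); congr (_ ▷▷ _).
rewrite -[RHS]dag_id -[in RHS]zig !dag_comp !dagK !bhom_dag dag_id !dagK !compA.
by [].
Qed.

End LeftModules.

(** * Coevaluations for a right module category *)

Section RightModules.
Variables (K : numClosedFieldType) (A M : unitaryCat K) (T : tensorStr A).
Variable G : rightModule M T.
Local Notation "a ⊗ b" := (bobj (tens T) a b).
Local Notation "f ⊗⊗ g" := (bhom (tens T) f g).
Local Notation "m ◁ b" := (bobj (ract G) m b).
Local Notation "f ◁◁ g" := (bhom (ract G) f g).
Local Notation α := (rassoc G).
Local Notation r := (runit G).
Local Notation one := (tone T).
Let ax := ract_axioms G.
Let tax := tens_axioms T.

Lemma runit_act_inj x y (f g : hom x y) :
  f ◁◁ idm one = g ◁◁ idm one -> f = g.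
Proof.
move=> e; apply: (unitary_injr (rm_unit_unitary ax x)).
by rewrite !(rm_unit_nat ax) e.
Qed.

(** Mirror image of [lunit_act]: after acting with the unit object and composing with an associator,
    the pentagon and the triangles for [a] and [m ◁ a] make the sides agree. *)
Lemma runit_act m a : (idm m ◁◁ trunit T a) ∘ α m a one = r (m ◁ a).
Proof.
apply: runit_act_inj.
apply: (unitary_injl (rm_assoc_unitary ax m a one)).
transitivity ((idm m ◁◁ (idm a ⊗⊗ tlunit T one)) ∘
    (α m a (one ⊗ one) ∘ α (m ◁ a) one one)); last first.
  by rewrite -(rm_triangle ax) !compA (rm_assoc_nat ax) bhom_id.
rewrite bhom_l_comp compA -(rm_assoc_nat ax).
rewrite -(ta_triangle tax) bhom_r_comp -!compA; congr (_ ∘ _).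
by rewrite !compA (rm_pentagon ax).
Qed.

Lemma runit_act_dag m a : α m a one ∘ (r (m ◁ a))^† = idm m ◁◁ (trunit T a)^†.
Proof.
rewrite -runit_act dag_comp bhom_dag dag_id.
exact: unitaryVKl (rm_assoc_unitary ax _ _ _).
Qed.

Lemma runit_nat_dag x y (f : hom x y) :
  (f ◁◁ idm one) ∘ (r x)^† = (r y)^† ∘ f.
Proof.
rewrite -[LHS]dagK dag_comp dagK bhom_dag dag_id.
by rewrite -(rm_unit_nat ax) dag_comp dagK.
Qed.

Lemma rassoc_nat_dag a a' b b' c c' (f : hom a a') (g : hom b b') (h : hom c c') :
  ((f ◁◁ g) ◁◁ h) ∘ (α a b c)^† = (α a' b' c')^† ∘ (f ◁◁ (g ⊗⊗ h)).
Proof.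
apply: (unitary_injr (rm_assoc_unitary ax _ _ _)).
rewrite unitaryVKr; last exact: rm_assoc_unitary ax _ _ _.
rewrite -compA (rm_assoc_nat ax) unitaryKl //; exact: rm_assoc_unitary ax _ _ _.
Qed.

Definition rcoev b b' (R : hom one (b ⊗ b')) u : hom u ((u ◁ b) ◁ b') :=
  locked_with coev_key ((α u b b')^† ∘ (idm u ◁◁ R) ∘ (r u)^†).

Lemma rcoevE b b' (R : hom one (b ⊗ b')) u :
  rcoev R u = (α u b b')^† ∘ (idm u ◁◁ R) ∘ (r u)^†.
Proof. by rewrite /rcoev unlock. Qed.

Lemma rcoev_nat b b' (R : hom one (b ⊗ b')) x y (f : hom x y) :
  ((f ◁◁ idm b) ◁◁ idm b') ∘ rcoev R x = rcoev R y ∘ f.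
Proof.
rewrite !rcoevE !compA rassoc_nat_dag bhom_id -!compA.
by rewrite (comp_rw _ (bhom_exchange _ f R)) runit_nat_dag.
Qed.

Lemma rcoev_dim b b' (R : hom one (b ⊗ b')) q u :
  R^† ∘ R = q *: idm one -> (rcoev R u)^† ∘ rcoev R u = q *: idm u.
Proof.
move=> Rq; rewrite !rcoevE !dag_comp !dagK -!compA.
rewrite (unitaryVKl _ (rm_assoc_unitary ax _ _ _)).
rewrite (compA (_ ◁◁ _)^†) bhom_dag dag_id -bhom_r_comp Rq.
rewrite (linZ (bhom_linr _ _)) bhom_id compZl comp1m compZr.
by rewrite (unitaryV (rm_unit_unitary ax u)).
Qed.

(** As for [lcoev_zigzag], but the reduction ends in the first conjugate equation itself rather than
    its dagger. *)
Lemma rcoev_zigzag b b' (R : hom one (b' ⊗ b)) (R' : hom one (b ⊗ b')) u :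
  conjugate_eqs R R' -> ((rcoev R' u)^† ◁◁ idm b) ∘ rcoev R (u ◁ b) = idm (u ◁ b).
Proof.
move=> [zig _]; rewrite !rcoevE !dag_comp !dagK !bhom_l_comp -!compA.
have pent : (α u b b' ◁◁ idm b) ∘ (α (u ◁ b) b' b)^† =
    (α u (b ⊗ b') b)^† ∘ ((idm u ◁◁ (tassoc T b b' b)^†) ∘ α u b (b' ⊗ b)).
  rewrite compA; apply/esym.
  apply: (unitary_move (rm_assoc_unitary ax _ _ _)).
  rewrite -compA -(rm_pentagon ax) -!compA.
  rewrite (comp_rw1 _ (esym (bhom_r_comp _ _ _ _))).
  rewrite (unitaryE (ta_assoc_unitary tax _ _ _)) bhom_id comp1m.
  exact: unitaryKl (rm_assoc_unitary ax _ _ _).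
rewrite (comp_rw _ pent) -!compA.
have nat : α u b (b' ⊗ b) ∘ (idm (u ◁ b) ◁◁ R) =
   (idm u ◁◁ (idm b ⊗⊗ R)) ∘ α u b one.
  by rewrite (rm_assoc_nat ax) bhom_id.
rewrite (comp_rw _ nat) runit_act_dag.
have nat' : ((idm u ◁◁ R')^† ◁◁ idm b) ∘ (α u (b ⊗ b') b)^† =
   (α u one b)^† ∘ (idm u ◁◁ (R'^† ⊗⊗ idm b)).
  by rewrite bhom_dag dag_id rassoc_nat_dag.
rewrite (comp_rw _ nat').
have tri : (r u ◁◁ idm b) ∘ (α u one b)^† = idm u ◁◁ tlunit T b.
  by apply/esym/(unitary_move (rm_assoc_unitary ax _ _ _)); rewrite (rm_triangle ax).
rewrite (comp_rw1 _ tri) -!bhom_r_comp.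
rewrite -(bhom_id (ract G) u b); congr (idm u ◁◁ _).
by rewrite -[RHS]zig !compA.
Qed.

End RightModules.

(** * Compatibility of the coevaluations with the middle associator *)

Section BimoduleCoherence.
Variables (K : numClosedFieldType) (C D : unitaryFusionCat K).
Variables (M : semisimpleCat K) (B : bimodule C D M).
Local Notation "a ▷ m" := (bobj (lact (bl B)) a m).
Local Notation "f ▷▷ g" := (bhom (lact (bl B)) f g).
Local Notation "m ◁ b" := (bobj (ract (br B)) m b).
Local Notation "f ◁◁ g" := (bhom (ract (br B)) f g).
Local Notation mid := (bmid B).
Let ax := bmid_axioms B.

(** The left pentagon and naturality of [mid] carry [R] past [b], and the left triangle absorbs the
    remaining unitor. *)
Lemma lcoev_act (a a' : C) R (u : M) (b : D) :
  (idm a' ▷▷ mid a u b) ∘ mid a' (a ▷ u) b ∘ (lcoev (bl B) R u ◁◁ idm b)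
    = lcoev (bl B) R (u ◁ b).
Proof.
rewrite !lcoevE !bhom_l_comp !compA (bm_pentagon_l ax) -!compA.
rewrite (comp_rw _ (esym (bm_nat ax _ _ _))) bhom_id; congr (_ ∘ (_ ∘ _)).
rewrite -[LHS]dagK; congr (_^†).
rewrite dag_comp bhom_dag dagK dag_id -(bm_triangle_l ax).
exact: unitaryKr (bm_unitary ax _ _ _).
Qed.

Lemma rcoev_act (a : C) (u : M) (b b' : D) R :
  mid a (u ◁ b) b' ∘ (mid a u b ◁◁ idm b') ∘ rcoev (br B) R (a ▷ u)
    = idm a ▷▷ rcoev (br B) R u.
Proof.
rewrite !rcoevE !bhom_r_comp !compA.
have pent : mid a (u ◁ b) b' ∘ (mid a u b ◁◁ idm b') ∘ (rassoc (br B) (a ▷ u) b b')^† =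
   (idm a ▷▷ (rassoc (br B) u b b')^†) ∘ mid a u (bobj (tens (uf_tens D)) b b').
  apply/esym/(unitary_move (rm_assoc_unitary (ract_axioms _) _ _ _)).
  rewrite -compA -(bm_pentagon_r ax) !compA -bhom_r_comp.
  rewrite (unitaryE (rm_assoc_unitary (ract_axioms _) _ _ _)) bhom_id comp1m.
  by [].
rewrite pent -!compA; congr (_ ∘ _).
rewrite -(bhom_id (lact (bl B)) a u) (comp_rw _ (esym (bm_nat ax _ _ _))).
congr (_ ∘ _); rewrite -(bm_triangle_r ax) dag_comp bhom_dag dag_id.
exact: unitaryVKl (bm_unitary ax _ _ _).
Qed.

End BimoduleCoherence.

(** * The dual of the dual of a simple object *)

Section DoubleDual.
Variables (K : numClosedFieldType) (C : unitaryFusionCat K).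

(** Makes the coevaluation lemmas for module categories available inside [C]. *)
Definition regular_left_module : leftModule (uf_tens C) C.
Proof.
refine (@LeftModule _ _ (uf_tens C) C (tens (uf_tens C)) (tassoc _) (tlunit _) _).
have [ha hl hr na nl nr pent tri] := tens_axioms (uf_tens C).
split=> //.
Defined.

(* Bending [st_R a] gives a nonzero morphism [a -> bar (bar a) ⊗ 1]. *)
Lemma bar_bar (s : standard_data C) (a : Irr C) : bar s (bar s a) = a.
Proof.
apply/esym/irr_inj; pose T := uf_tens C; pose L := regular_left_module.
pose bb := irr (bar s (bar s a)).
pose W : hom (irr a) (bobj (tens T) bb (tone T)) :=
  bhom (tens T) (idm bb) (st_R s a)^† ∘ lcoev L (st_R s (bar s a)) (irr a).
apply: (iso_of_neq0 (f := trunit T bb ∘ W)); try exact: irr_simple.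
apply: contra_neq (idm_simple_neq0 (irr_simple a)) => W0.
have {}W0 : W = 0.
  rewrite -(unitaryKl W (ta_runit_unitary (tens_axioms T) bb)) W0.
  exact: compm0.
have R0 : st_R s a = 0.
  rewrite -[st_R s a]comp1m -(lcoev_zigzag L _ (st_conj s (bar s a))).
  rewrite -compA -(lcoev_nat L (st_R' s (bar s a)) (st_R s a)) compA.
  rewrite -(bhom_r_comp (tens T)).
  have -> : (lcoev L (st_R s (bar s a)) (irr a))^† ∘
     bhom (tens T) (idm bb) (st_R s a) = W^†.
    by rewrite /W [RHS]dag_comp bhom_dag dagK dag_id.
  by rewrite W0 dag0 (lin0 (bhom_linr _ _)) comp0m.
have [<- _] := st_conj s a.
by rewrite R0 (lin0 (bhom_linr _ _)) compm0 comp0m.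
Qed.

End DoubleDual.

(** * Tube algebras on pure tensors *)

Section Additivity.
Variable K : numClosedFieldType.

Lemma scalD (A : unitaryCat K) (x : A) (f g : hom x x) :
  scal (f + g) = scal f + scal g.
Proof. exact: (linD (@scal_linear _ _ x)). Qed.

Variables (A B E : unitaryCat K) (F : bifunctor A B E).

Lemma bhomDl a a' b b' (f f' : hom a a') (g : hom b b') :
  bhom F (f + f') g = bhom F f g + bhom F f' g.
Proof. exact: (linD (bhom_linl F g)). Qed.

Lemma bhomDr a a' b b' (f : hom a a') (g g' : hom b b') :
  bhom F f (g + g') = bhom F f g + bhom F f g'.
Proof. exact: (linD (bhom_linr F f)). Qed.

Lemma bhomZl a a' b b' c (f : hom a a') (g : hom b b') :
  bhom F (c *: f) g = c *: bhom F f g.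
Proof. exact: (linZ (bhom_linl F g)). Qed.

Lemma bhomZr a a' b b' c (f : hom a a') (g : hom b b') :
  bhom F f (c *: g) = c *: bhom F f g.
Proof. exact: (linZ (bhom_linr F f)). Qed.

End Additivity.

Definition linE := (compDl, compDr, compZl, compZr, bhomDl, bhomDr, bhomZl,
  bhomZr, scalD, scalZ).

(** * Structure maps of the left tube algebra *)

Section LeftTube.
Variables (K : numClosedFieldType) (C : unitaryFusionCat K).
Variables (M : semisimpleCat K) (L : leftModule (uf_tens C) M).
Local Notation "a ▷ m" := (bobj (lact L) a m).
Local Notation "f ▷▷ g" := (bhom (lact L) f g).
Variables (sC : standard_data C) (tC : dual_bases_system C).
Variables (tM : dual_bases_system M) (d : Irr M -> K).
Implicit Types (a : Irr C) (x y z w : Irr M).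

Lemma lelt_linl a x y z w (zeta : hom (irr a ▷ irr z) (irr w)) :
  linear (fun nu : hom (irr x) (irr a ▷ irr y) => lelt nu zeta).
Proof. by move=> c f g; rewrite /lelt ptens_linl (dinj_linear (l := (a, x, y, z, w))). Qed.

Lemma lelt_linr a x y z w (nu : hom (irr x) (irr a ▷ irr y)) :
  linear (fun zeta : hom (irr a ▷ irr z) (irr w) => lelt nu zeta).
Proof. by move=> c f g; rewrite /lelt ptens_linr (dinj_linear (l := (a, x, y, z, w))). Qed.

Lemma lelt_span (P : ltube L -> Prop) :
  P 0 -> (forall c v v', P v -> P v' -> P (c *: v + v')) ->
  (forall a x y z w (nu : hom (irr x) (irr a ▷ irr y))
    (zeta : hom (irr a ▷ irr z) (irr w)), P (lelt nu zeta)) ->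
  forall v, P v.
Proof.
move=> P0 Pl Pe v.
have Psum (I : Type) (r : seq I) (F : I -> ltube L) :
    (forall i, P (F i)) -> P (\sum_(i <- r) F i).
  move=> PF; elim: r => [|i r IH]; first by rewrite big_nil.
  by rewrite big_cons -[F i]scale1r; apply: Pl.
rewrite -(sum_dinj v); apply: (Psum _ _ _) => -[[[[a x] y] z] w].
rewrite [dproj _ _]tens_sum (lin_sum (dinj_linear (l := (a, x, y, z, w)))).
apply: (Psum _ _ _) => i; rewrite (lin_sum (dinj_linear (l := (a, x, y, z, w)))).
apply: (Psum _ _ _) => j; rewrite (linZ (dinj_linear (l := (a, x, y, z, w)))).
by rewrite -[_ *: _]addr0; apply: Pl => //; apply: Pe.
Qed.

(** This is how each skew-pairing axiom is reduced to pure tensors, one argument at a time. *)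
Lemma ltube_ext (E : lmodType K) (f g : ltube L -> E) :
  linear f -> linear g ->
  (forall a x y z w (nu : hom (irr x) (irr a ▷ irr y))
    (zeta : hom (irr a ▷ irr z) (irr w)), f (lelt nu zeta) = g (lelt nu zeta)) ->
  f =1 g.
Proof.
move=> fl gl fg; apply: lelt_span => //; first by rewrite !lin0.
by move=> c v v' e e'; rewrite fl gl e e'.
Qed.

Lemma lpart_linear a x y z w : linear (fun v : ltube L => lpart v a x y z w).
Proof. exact: (@dproj_linear _ _ _ (a, x, y, z, w)). Qed.

Lemma lpart_lelt a x y z w (nu : hom (irr x) (irr a ▷ irr y))
    (zeta : hom (irr a ▷ irr z) (irr w)) :
  lpart (lelt nu zeta) a x y z w = nu ⊠⊠ zeta.
Proof. exact: (@dproj_in _ _ _ (a, x, y, z, w) _). Qed.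

Lemma lpart_lelt_neq a x y z w (nu : hom (irr x) (irr a ▷ irr y))
    (zeta : hom (irr a ▷ irr z) (irr w)) a' x' y' z' w' :
  (a', x', y', z', w') != (a, x, y, z, w) -> lpart (lelt nu zeta) a' x' y' z' w' = 0.
Proof. exact: dproj_out. Qed.

Lemma sum_lpart_lelt (E : vectType K)
  (F : forall a x y z w, hom (irr x) (irr a ▷ irr y) -> hom (irr a ▷ irr z) (irr w) -> E)
  a x y z w (nu : hom (irr x) (irr a ▷ irr y)) (zeta : hom (irr a ▷ irr z) (irr w)) :
  (forall zeta, linear (fun nu => F a x y z w nu zeta)) ->
  (forall nu, linear (fun zeta => F a x y z w nu zeta)) ->
  \sum_a' \sum_x' \sum_y' \sum_z' \sum_w'
     tlift (F a' x' y' z' w') (lpart (lelt nu zeta) a' x' y' z' w')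
  = F a x y z w nu zeta.
Proof.
move=> Fl Fr.
rewrite (sum_only5 (i0 := a) (j0 := x) (l0 := y) (n0 := z) (q0 := w)).
  by rewrite lpart_lelt tlift_ptens.
by move=> a' x' y' z' w' ne; rewrite lpart_lelt_neq // tlift_0.
Qed.

Lemma ltube_mul_linl v' : linear (fun v => ltube_mul (L := L) tC v v').
Proof.
do 8 apply: linear_bigsum => ?.
exact: linear_o (tlift_linear _) (@lpart_linear _ _ _ _ _).
Qed.

Lemma ltube_mul_linr v : linear (fun v' => ltube_mul (L := L) tC v v').
Proof.
do 8 apply: linear_bigsum => ?; apply: tlift_linear_fun => nu zeta.
exact: linear_o (tlift_linear _) (@lpart_linear _ _ _ _ _).
Qed.

Lemma ltube_counit_linear : linear (fun v : ltube L => ltube_counit v : K^o).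
Proof.
do 3 apply: linear_bigsum => ?.
exact: linear_o (tlift_linear _) (@lpart_linear _ _ _ _ _).
Qed.

Lemma ltube_comul_linear : linear (fun v => ltube_comul (L := L) tM v).
Proof.
do 5 apply: linear_bigsum => ?.
exact: linear_o (tlift_linear _) (@lpart_linear _ _ _ _ _).
Qed.

Lemma ltube_antipode_linear : linear (fun v => ltube_antipode (L := L) sC d v).
Proof.
do 5 apply: linear_bigsum => ?.
exact: linear_o (tlift_linear _) (@lpart_linear _ _ _ _ _).
Qed.

Lemma ltube_mul_lelt a x y z w a' y' z' (nu : hom (irr x) (irr a ▷ irr y))
    (zeta : hom (irr a ▷ irr z) (irr w)) (nu' : hom (irr y) (irr a' ▷ irr y'))
    (zeta' : hom (irr a' ▷ irr z') (irr z)) :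
  ltube_mul tC (lelt nu zeta) (lelt nu' zeta') =
    \sum_k \sum_(i < db_size (tC k (bobj (tens (uf_tens C)) (irr a) (irr a'))))
      lelt ((tnth (db' (tC k _)) i ▷▷ idm (irr y'))
              ∘ (lassoc L (irr a) (irr a') (irr y'))^†
              ∘ (idm (irr a) ▷▷ nu') ∘ nu)
           (zeta ∘ (idm (irr a) ▷▷ zeta') ∘ lassoc L (irr a) (irr a') (irr z')
              ∘ (tnth (db (tC k _)) i ▷▷ idm (irr z'))).
Proof.
rewrite /ltube_mul.
rewrite (sum_only5 (i0 := a) (j0 := x) (l0 := y) (n0 := z) (q0 := w)); last first.
  move=> ? ? ? ? ? ne; do 3 rewrite big1 // => ? _.
  by rewrite (lpart_lelt_neq nu zeta) // tlift_0.
rewrite (sum_only3 (i0 := a') (j0 := y') (l0 := z')); last first.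
  move=> a1 y1 z1 ne; apply: tlift_eq0 => nu1 zeta1.
  rewrite lpart_lelt_neq ?tlift_0 //; apply: contraNneq ne => -[-> -> ->].
  by [].
rewrite !lpart_lelt.
(* As a function of four morphisms the summand can be checked to be linear in each, which the two
   uses of [tlift_ptens] require. *)
pose F (nu : hom (irr x) (irr a ▷ irr y)) (zeta : hom (irr a ▷ irr z) (irr w))
    (nu' : hom (irr y) (irr a' ▷ irr y')) (zeta' : hom (irr a' ▷ irr z') (irr z))
    := \sum_k
  \sum_(i < db_size (tC k (bobj (tens (uf_tens C)) (irr a) (irr a'))))
      lelt ((tnth (db' (tC k _)) i ▷▷ idm (irr y'))
              ∘ (lassoc L (irr a) (irr a') (irr y'))^†
              ∘ (idm (irr a) ▷▷ nu') ∘ nu : hom (irr x) _)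
           (zeta ∘ (idm (irr a) ▷▷ zeta') ∘ lassoc L (irr a) (irr a') (irr z')
              ∘ (tnth (db (tC k _)) i ▷▷ idm (irr z')) : hom _ (irr w)).
have Fl g1 f2 g2 : linear (fun f1 => F f1 g1 f2 g2).
  by do 2 apply: linear_bigsum => ?; move=> c f g; rewrite !linE lelt_linl.
have Fr f1 f2 g2 : linear (fun g1 => F f1 g1 f2 g2).
  by do 2 apply: linear_bigsum => ?; move=> c f g; rewrite !linE lelt_linr.
have Fl' f1 g1 g2 : linear (fun f2 => F f1 g1 f2 g2).
  by do 2 apply: linear_bigsum => ?; move=> c f g; rewrite !linE lelt_linl.
have Fr' f1 g1 f2 : linear (fun g2 => F f1 g1 f2 g2).
  by do 2 apply: linear_bigsum => ?; move=> c f g; rewrite !linE lelt_linr.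
transitivity (tlift (fun nu zeta => tlift (F nu zeta) (nu' ⊠⊠ zeta')) (nu ⊠⊠ zeta)).
  by [].
rewrite tlift_ptens.
- by rewrite tlift_ptens.
- by move=> zeta1; apply: tlift_linear_fun.
- by move=> nu1; apply: tlift_linear_fun.
Qed.

Lemma ltube_mul_lelt_neq a x y z w a' x' y' z' w'
    (nu : hom (irr x) (irr a ▷ irr y)) (zeta : hom (irr a ▷ irr z) (irr w))
    (nu' : hom (irr x') (irr a' ▷ irr y')) (zeta' : hom (irr a' ▷ irr z') (irr w')) :
  (x', w') != (y, z) -> ltube_mul tC (lelt nu zeta) (lelt nu' zeta') = 0.
Proof.
move=> ne; rewrite /ltube_mul.
rewrite (sum_only5 (i0 := a) (j0 := x) (l0 := y) (n0 := z) (q0 := w)); last first.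
  move=> ? ? ? ? ? ne'; do 3 rewrite big1 // => ? _.
  by rewrite (lpart_lelt_neq nu zeta) // tlift_0.
do 3 rewrite big1 // => ? _; apply: tlift_eq0 => ? ?.
by rewrite lpart_lelt_neq ?tlift_0 //; apply: contraNneq ne => -[_ -> _ _ ->].
Qed.

Lemma ltube_counit_lelt a x y (nu : hom (irr x) (irr a ▷ irr y))
    (zeta : hom (irr a ▷ irr y) (irr x)) :
  ltube_counit (lelt nu zeta) = scal (zeta ∘ nu).
Proof.
rewrite /ltube_counit (sum_only3 (i0 := a) (j0 := x) (l0 := y)).
  by rewrite lpart_lelt tlift_ptens // => ? ? ? ?; rewrite !linE.
move=> a' x' y' ne; rewrite lpart_lelt_neq ?tlift_0 //.
by apply: contraNneq ne => -[-> -> -> _ _].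
Qed.

Lemma ltube_counit_lelt_neq a x y z w (nu : hom (irr x) (irr a ▷ irr y))
    (zeta : hom (irr a ▷ irr z) (irr w)) :
  (z, w) != (y, x) -> ltube_counit (lelt nu zeta) = 0.
Proof.
move=> ne; rewrite /ltube_counit; do 3 rewrite big1 // => ? _.
rewrite lpart_lelt_neq ?tlift_0 //.
by apply: contraNneq ne => -[_ -> -> -> ->].
Qed.

Lemma ltube_comul_lelt a x y z w (nu : hom (irr x) (irr a ▷ irr y))
    (zeta : hom (irr a ▷ irr z) (irr w)) :
  ltube_comul tM (lelt nu zeta) =
    \sum_i \sum_k \sum_(j < db_size (tM k (irr a ▷ irr i)))
      lelt (tnth (db (tM k (irr a ▷ irr i))) j) zeta
        ⊠⊠ lelt nu (tnth (db' (tM k (irr a ▷ irr i))) j).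
Proof.
apply: (sum_lpart_lelt (F := fun a x y z w nu zeta => _ : ltube L ⊠ ltube L)).
- move=> g; do 3 apply: linear_bigsum => ?; move=> c ? ?.
  by rewrite lelt_linl ptens_linr.
- move=> f; do 3 apply: linear_bigsum => ?; move=> c ? ?.
  by rewrite lelt_linr ptens_linl.
Qed.

Lemma ltube_antipode_lelt a x y z w (nu : hom (irr x) (irr a ▷ irr y))
    (zeta : hom (irr a ▷ irr z) (irr w)) :
  ltube_antipode sC d (lelt nu zeta) =
    (d z / d w) *:
    lelt ((idm (irr (bar sC a)) ▷▷ zeta) ∘ lcoev L (st_R sC a) (irr z))
         ((lcoev L (st_R sC a) (irr y))^† ∘ (idm (irr (bar sC a)) ▷▷ nu)).
Proof.
rewrite !lcoevE !dag_comp dagK bhom_dag dag_id !compA.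
apply: (sum_lpart_lelt (F := fun a x y z w nu zeta => _ : ltube L)).
- by move=> g c ? ?; rewrite !linE lelt_linr scalerDr !scalerA mulrC.
- by move=> f c ? ?; rewrite !linE lelt_linl scalerDr !scalerA mulrC.
Qed.

(** A preimage of a pure tensor is obtained by bending its leg back with the other half of the
    standard solution; the zigzag identities undo the bending. *)
Lemma ltube_antipode_surj : (forall m, d m != 0) ->
  forall v : ltube L, exists v', ltube_antipode sC d v' = v.
Proof.
move=> d0; apply: lelt_span.
- by exists 0; rewrite (lin0 ltube_antipode_linear).
- by move=> c _ _ [v <-] [v' <-]; exists (c *: v + v'); rewrite ltube_antipode_linear.
(* The antipode only produces labels of the form [bar a]; by [bar_bar] every label has that form. *)
move=> a x y z w; rewrite -(bar_bar sC a); move: (bar sC a) => {}a nu zeta.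
pose nu' : hom (irr z) (irr a ▷ irr w) :=
  (idm (irr a) ▷▷ zeta) ∘ lcoev L (st_R' sC a) (irr z).
pose zeta' : hom (irr a ▷ irr x) (irr y) :=
  (lcoev L (st_R' sC a) (irr y))^† ∘ (idm (irr a) ▷▷ nu).
(* The last two labels of [lelt nu' zeta'] are [x] and [y], so the antipode multiplies it by
   [d x / d y]. *)
exists ((d x / d y)^-1 *: lelt nu' zeta').
rewrite (linZ ltube_antipode_linear) ltube_antipode_lelt scalerA.
rewrite mulVf ?scale1r; last by rewrite mulf_neq0 ?invr_neq0.
have zag (y0 : M) : (idm (irr (bar sC a)) ▷▷ (lcoev L (st_R' sC a) y0)^†)
      ∘ lcoev L (st_R sC a) (irr (bar sC a) ▷ y0) = idm _.
  by apply: lcoev_zigzag; case: (st_conj sC a).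
congr (lelt _ _).
  by rewrite /zeta' bhom_r_comp -compA lcoev_nat compA zag comp1m.
(* Naturality and zigzag are stated for the coevaluation, and here its dagger occurs; hence the
   passage through daggers. *)
rewrite /nu' bhom_r_comp compA -[_ ∘ (_ ▷▷ (_ ▷▷ zeta))]dagK dag_comp dagK.
rewrite !bhom_dag !dag_id lcoev_nat dag_comp dagK -compA -[_^† ∘ _]dagK.
by rewrite dag_comp dagK bhom_dag dag_id zag dag_id compm1.
Qed.

End LeftTube.

(** * Structure maps of the right tube algebra *)

Section RightTube.
Variables (K : numClosedFieldType) (D : unitaryFusionCat K).
Variables (M : semisimpleCat K) (G : rightModule M (uf_tens D)).
Local Notation "m ◁ b" := (bobj (ract G) m b).
Local Notation "f ◁◁ g" := (bhom (ract G) f g).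
Variables (sD : standard_data D) (tD : dual_bases_system D).
Variables (tM : dual_bases_system M) (d : Irr M -> K).
Implicit Types (b : Irr D) (s t u v : Irr M).

Lemma relt_linl b s t u v (gamma : hom (irr u ◁ irr b) (irr v)) :
  linear (fun mu : hom (irr s) (irr t ◁ irr b) => relt mu gamma).
Proof. by move=> c f g; rewrite /relt ptens_linl (dinj_linear (l := (b, s, t, u, v))). Qed.

Lemma relt_linr b s t u v (mu : hom (irr s) (irr t ◁ irr b)) :
  linear (fun gamma : hom (irr u ◁ irr b) (irr v) => relt mu gamma).
Proof. by move=> c f g; rewrite /relt ptens_linr (dinj_linear (l := (b, s, t, u, v))). Qed.

Lemma relt_span (P : rtube G -> Prop) :
  P 0 -> (forall c r r', P r -> P r' -> P (c *: r + r')) ->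
  (forall b s t u v (mu : hom (irr s) (irr t ◁ irr b))
    (gamma : hom (irr u ◁ irr b) (irr v)), P (relt mu gamma)) ->
  forall r, P r.
Proof.
move=> P0 Pl Pe r.
have Psum (I : Type) (q : seq I) (F : I -> rtube G) :
    (forall i, P (F i)) -> P (\sum_(i <- q) F i).
  move=> PF; elim: q => [|i q IH]; first by rewrite big_nil.
  by rewrite big_cons -[F i]scale1r; apply: Pl.
rewrite -(sum_dinj r); apply: (Psum _ _ _) => -[[[[b s] t] u] v].
rewrite [dproj _ _]tens_sum (lin_sum (dinj_linear (l := (b, s, t, u, v)))).
apply: (Psum _ _ _) => i; rewrite (lin_sum (dinj_linear (l := (b, s, t, u, v)))).
apply: (Psum _ _ _) => j; rewrite (linZ (dinj_linear (l := (b, s, t, u, v)))).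
by rewrite -[_ *: _]addr0; apply: Pl => //; apply: Pe.
Qed.

Lemma rtube_ext (E : lmodType K) (f g : rtube G -> E) :
  linear f -> linear g ->
  (forall b s t u v (mu : hom (irr s) (irr t ◁ irr b))
    (gamma : hom (irr u ◁ irr b) (irr v)), f (relt mu gamma) = g (relt mu gamma)) ->
  f =1 g.
Proof.
move=> fl gl fg; apply: relt_span => //; first by rewrite !lin0.
by move=> c r r' e e'; rewrite fl gl e e'.
Qed.

Lemma rpart_linear b s t u v : linear (fun r : rtube G => rpart r b s t u v).
Proof. exact: (@dproj_linear _ _ _ (b, s, t, u, v)). Qed.

Lemma rpart_relt b s t u v (mu : hom (irr s) (irr t ◁ irr b))
    (gamma : hom (irr u ◁ irr b) (irr v)) :
  rpart (relt mu gamma) b s t u v = mu ⊠⊠ gamma.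
Proof. exact: (@dproj_in _ _ _ (b, s, t, u, v) _). Qed.

Lemma rpart_relt_neq b s t u v (mu : hom (irr s) (irr t ◁ irr b))
    (gamma : hom (irr u ◁ irr b) (irr v)) b' s' t' u' v' :
  (b', s', t', u', v') != (b, s, t, u, v) -> rpart (relt mu gamma) b' s' t' u' v' = 0.
Proof. exact: dproj_out. Qed.

Lemma sum_rpart_relt (E : vectType K)
  (F : forall b s t u v, hom (irr s) (irr t ◁ irr b) -> hom (irr u ◁ irr b) (irr v) -> E)
  b s t u v (mu : hom (irr s) (irr t ◁ irr b)) (gamma : hom (irr u ◁ irr b) (irr v)) :
  (forall gamma, linear (fun mu => F b s t u v mu gamma)) ->
  (forall mu, linear (fun gamma => F b s t u v mu gamma)) ->
  \sum_b' \sum_s' \sum_t' \sum_u' \sum_v'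
     tlift (F b' s' t' u' v') (rpart (relt mu gamma) b' s' t' u' v')
  = F b s t u v mu gamma.
Proof.
move=> Fl Fr.
rewrite (sum_only5 (i0 := b) (j0 := s) (l0 := t) (n0 := u) (q0 := v)).
  by rewrite rpart_relt tlift_ptens.
by move=> b' s' t' u' v' ne; rewrite rpart_relt_neq // tlift_0.
Qed.

Lemma rtube_mul_linl r' : linear (fun r => rtube_mul (G := G) tD r r').
Proof.
do 8 apply: linear_bigsum => ?.
exact: linear_o (tlift_linear _) (@rpart_linear _ _ _ _ _).
Qed.

Lemma rtube_mul_linr r : linear (fun r' => rtube_mul (G := G) tD r r').
Proof.
do 8 apply: linear_bigsum => ?; apply: tlift_linear_fun => mu gamma.
exact: linear_o (tlift_linear _) (@rpart_linear _ _ _ _ _).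
Qed.

Lemma rtube_counit_linear : linear (fun r : rtube G => rtube_counit r : K^o).
Proof.
do 3 apply: linear_bigsum => ?.
exact: linear_o (tlift_linear _) (@rpart_linear _ _ _ _ _).
Qed.

Lemma rtube_comul_linear : linear (fun r => rtube_comul (G := G) tM r).
Proof.
do 5 apply: linear_bigsum => ?.
exact: linear_o (tlift_linear _) (@rpart_linear _ _ _ _ _).
Qed.

Lemma rtube_antipode_linear : linear (fun r => rtube_antipode (G := G) sD d r).
Proof.
do 5 apply: linear_bigsum => ?.
exact: linear_o (tlift_linear _) (@rpart_linear _ _ _ _ _).
Qed.

Lemma rtube_mul_relt b s t u v b' t' u' (mu : hom (irr s) (irr t ◁ irr b))
    (gamma : hom (irr u ◁ irr b) (irr v)) (mu' : hom (irr t) (irr t' ◁ irr b'))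
    (gamma' : hom (irr u' ◁ irr b') (irr u)) :
  rtube_mul tD (relt mu gamma) (relt mu' gamma') =
    \sum_k \sum_(i < db_size (tD k (bobj (tens (uf_tens D)) (irr b') (irr b))))
      relt ((idm (irr t') ◁◁ tnth (db' (tD k _)) i)
              ∘ rassoc G (irr t') (irr b') (irr b)
              ∘ (mu' ◁◁ idm (irr b)) ∘ mu)
           (gamma ∘ (gamma' ◁◁ idm (irr b)) ∘ (rassoc G (irr u') (irr b') (irr b))^†
              ∘ (idm (irr u') ◁◁ tnth (db (tD k _)) i)).
Proof.
rewrite /rtube_mul.
rewrite (sum_only5 (i0 := b) (j0 := s) (l0 := t) (n0 := u) (q0 := v)); last first.
  move=> ? ? ? ? ? ne; do 3 rewrite big1 // => ? _.
  by rewrite (rpart_relt_neq mu gamma) // tlift_0.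
rewrite (sum_only3 (i0 := b') (j0 := t') (l0 := u')); last first.
  move=> a1 y1 z1 ne; apply: tlift_eq0 => nu1 zeta1.
  rewrite rpart_relt_neq ?tlift_0 //; apply: contraNneq ne => -[-> -> ->].
  by [].
rewrite !rpart_relt.
pose F (mu : hom (irr s) (irr t ◁ irr b)) (gamma : hom (irr u ◁ irr b) (irr v))
    (mu' : hom (irr t) (irr t' ◁ irr b')) (gamma' : hom (irr u' ◁ irr b') (irr u))
    := \sum_k
  \sum_(i < db_size (tD k (bobj (tens (uf_tens D)) (irr b') (irr b))))
      relt ((idm (irr t') ◁◁ tnth (db' (tD k _)) i)
              ∘ rassoc G (irr t') (irr b') (irr b)
              ∘ (mu' ◁◁ idm (irr b)) ∘ mu : hom (irr s) _)
           (gamma ∘ (gamma' ◁◁ idm (irr b)) ∘ (rassoc G (irr u') (irr b') (irr b))^†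
              ∘ (idm (irr u') ◁◁ tnth (db (tD k _)) i) : hom _ (irr v)).
have Fl g1 f2 g2 : linear (fun f1 => F f1 g1 f2 g2).
  by do 2 apply: linear_bigsum => ?; move=> c f g; rewrite !linE relt_linl.
have Fr f1 f2 g2 : linear (fun g1 => F f1 g1 f2 g2).
  by do 2 apply: linear_bigsum => ?; move=> c f g; rewrite !linE relt_linr.
have Fl' f1 g1 g2 : linear (fun f2 => F f1 g1 f2 g2).
  by do 2 apply: linear_bigsum => ?; move=> c f g; rewrite !linE relt_linl.
have Fr' f1 g1 f2 : linear (fun g2 => F f1 g1 f2 g2).
  by do 2 apply: linear_bigsum => ?; move=> c f g; rewrite !linE relt_linr.
transitivity (tlift (fun mu gamma => tlift (F mu gamma) (mu' ⊠⊠ gamma')) (mu ⊠⊠ gamma)).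
  by [].
rewrite tlift_ptens.
- by rewrite tlift_ptens.
- by move=> zeta1; apply: tlift_linear_fun.
- by move=> nu1; apply: tlift_linear_fun.
Qed.

Lemma rtube_mul_relt_neq b s t u v b' s' t' u' v'
    (mu : hom (irr s) (irr t ◁ irr b)) (gamma : hom (irr u ◁ irr b) (irr v))
    (mu' : hom (irr s') (irr t' ◁ irr b')) (gamma' : hom (irr u' ◁ irr b') (irr v')) :
  (s', v') != (t, u) -> rtube_mul tD (relt mu gamma) (relt mu' gamma') = 0.
Proof.
move=> ne; rewrite /rtube_mul.
rewrite (sum_only5 (i0 := b) (j0 := s) (l0 := t) (n0 := u) (q0 := v)); last first.
  move=> ? ? ? ? ? ne'; do 3 rewrite big1 // => ? _.
  by rewrite (rpart_relt_neq mu gamma) // tlift_0.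
do 3 rewrite big1 // => ? _; apply: tlift_eq0 => ? ?.
by rewrite rpart_relt_neq ?tlift_0 //; apply: contraNneq ne => -[_ -> _ _ ->].
Qed.

Lemma rtube_counit_relt b s t (mu : hom (irr s) (irr t ◁ irr b))
    (gamma : hom (irr t ◁ irr b) (irr s)) :
  rtube_counit (relt mu gamma) = scal (gamma ∘ mu).
Proof.
rewrite /rtube_counit (sum_only3 (i0 := b) (j0 := s) (l0 := t)).
  by rewrite rpart_relt tlift_ptens // => ? ? ? ?; rewrite !linE.
move=> b' s' t' ne; rewrite rpart_relt_neq ?tlift_0 //.
by apply: contraNneq ne => -[-> -> -> _ _].
Qed.

Lemma rtube_counit_relt_neq b s t u v (mu : hom (irr s) (irr t ◁ irr b))
    (gamma : hom (irr u ◁ irr b) (irr v)) :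
  (u, v) != (t, s) -> rtube_counit (relt mu gamma) = 0.
Proof.
move=> ne; rewrite /rtube_counit; do 3 rewrite big1 // => ? _.
rewrite rpart_relt_neq ?tlift_0 //.
by apply: contraNneq ne => -[_ -> -> -> ->].
Qed.

Lemma rtube_comul_relt b s t u v (mu : hom (irr s) (irr t ◁ irr b))
    (gamma : hom (irr u ◁ irr b) (irr v)) :
  rtube_comul tM (relt mu gamma) =
    \sum_i \sum_k \sum_(j < db_size (tM k (irr i ◁ irr b)))
      relt (tnth (db (tM k (irr i ◁ irr b))) j) gamma
        ⊠⊠ relt mu (tnth (db' (tM k (irr i ◁ irr b))) j).
Proof.
apply: (sum_rpart_relt (F := fun b s t u v mu gamma => _ : rtube G ⊠ rtube G)).
- move=> g; do 3 apply: linear_bigsum => ?; move=> c ? ?.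
  by rewrite relt_linl ptens_linr.
- move=> f; do 3 apply: linear_bigsum => ?; move=> c ? ?.
  by rewrite relt_linr ptens_linl.
Qed.

Lemma rtube_antipode_relt b s t u v (mu : hom (irr s) (irr t ◁ irr b))
    (gamma : hom (irr u ◁ irr b) (irr v)) :
  rtube_antipode sD d (relt mu gamma) =
    (d u / d v) *:
    relt ((gamma ◁◁ idm (irr (bar sD b))) ∘ rcoev G (st_R' sD b) (irr u))
         ((rcoev G (st_R' sD b) (irr t))^† ∘ (mu ◁◁ idm (irr (bar sD b)))).
Proof.
rewrite !rcoevE !dag_comp !dagK bhom_dag dag_id !compA.
apply: (sum_rpart_relt (F := fun b s t u v mu gamma => _ : rtube G)).
- by move=> g c ? ?; rewrite !linE relt_linr scalerDr !scalerA mulrC.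
- by move=> f c ? ?; rewrite !linE relt_linl scalerDr !scalerA mulrC.
Qed.

(** As on the left; the antipode bends with [st_R'], so the preimage uses [st_R]. *)
Lemma rtube_antipode_surj : (forall m, d m != 0) ->
  forall r : rtube G, exists r', rtube_antipode sD d r' = r.
Proof.
move=> d0; apply: relt_span.
- by exists 0; rewrite (lin0 rtube_antipode_linear).
- by move=> c _ _ [r <-] [r' <-]; exists (c *: r + r'); rewrite rtube_antipode_linear.
move=> b s t u v; rewrite -(bar_bar sD b); move: (bar sD b) => {}b mu gamma.
pose mu' : hom (irr u) (irr v ◁ irr b) :=
  (gamma ◁◁ idm (irr b)) ∘ rcoev G (st_R sD b) (irr u).
pose gamma' : hom (irr s ◁ irr b) (irr t) :=
  (rcoev G (st_R sD b) (irr t))^† ∘ (mu ◁◁ idm (irr b)).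
exists ((d s / d t)^-1 *: relt mu' gamma').
rewrite (linZ rtube_antipode_linear) rtube_antipode_relt scalerA.
rewrite mulVf ?scale1r; last by rewrite mulf_neq0 ?invr_neq0.
have zag (m : M) : ((rcoev G (st_R sD b) m)^† ◁◁ idm (irr (bar sD b)))
      ∘ rcoev G (st_R' sD b) (m ◁ irr (bar sD b)) = idm _.
  by apply: rcoev_zigzag; case: (st_conj sD b).
congr (relt _ _).
  by rewrite /gamma' bhom_l_comp -compA rcoev_nat compA zag comp1m.
rewrite /mu' bhom_l_comp compA -[_ ∘ ((gamma ◁◁ _) ◁◁ _)]dagK dag_comp dagK.
rewrite !bhom_dag !dag_id rcoev_nat dag_comp dagK -compA -[_^† ∘ _]dagK.
by rewrite dag_comp dagK bhom_dag dag_id zag dag_id compm1.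
Qed.

End RightTube.

(** * The pairing *)

Section Pairing.
Variables (K : numClosedFieldType) (C D : unitaryFusionCat K).
Variables (M : semisimpleCat K) (B : bimodule C D M).
Local Notation "a ▷ m" := (bobj (lact (bl B)) a m).
Local Notation "f ▷▷ g" := (bhom (lact (bl B)) f g).
Local Notation "m ◁ b" := (bobj (ract (br B)) m b).
Local Notation "f ◁◁ g" := (bhom (ract (br B)) f g).
Local Notation mid := (bmid B).
Local Notation p := (@tube_pairing K C D M B).
Let ax := bmid_axioms B.
Implicit Types (a : Irr C) (b : Irr D) (s t u v x y z w : Irr M).

Lemma tube_pairing_linl l : linear (fun r => p r l : K^o).
Proof.
do 6 apply: linear_bigsum => ?.
exact: linear_o (tlift_linear _) (@rpart_linear _ _ _ _ _ _ _ _ _).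
Qed.

Lemma tube_pairing_linr r : linear (fun l => p r l : K^o).
Proof.
do 6 apply: linear_bigsum => ?; apply: tlift_linear_fun => ? ?.
exact: linear_o (tlift_linear _) (@lpart_linear _ _ _ _ _ _ _ _ _).
Qed.

Lemma tube_pairing_elt a b s t u v
    (mu : hom (irr s) (irr t ◁ irr b)) (gamma : hom (irr u ◁ irr b) (irr v))
    (nu : hom (irr t) (irr a ▷ irr u)) (zeta : hom (irr a ▷ irr v) (irr s)) :
  p (relt mu gamma) (lelt nu zeta)
    = scal (zeta ∘ (idm (irr a) ▷▷ gamma) ∘ mid (irr a) (irr u) (irr b)
              ∘ (nu ◁◁ idm (irr b)) ∘ mu).
Proof.
rewrite /tube_pairing.
rewrite (sum_only5 (i0 := b) (j0 := s) (l0 := t) (n0 := u) (q0 := v)); last first.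
  move=> ? ? ? ? ? ne; rewrite big1 // => ? _.
  by rewrite (rpart_relt_neq mu gamma) // tlift_0.
rewrite (sum_only1 (i0 := a)) => [|a' ne]; last first.
  apply: tlift_eq0 => ? ?; rewrite lpart_lelt_neq ?tlift_0 //.
  by apply: contraNneq ne => -[->].
rewrite rpart_relt lpart_lelt tlift_ptens.
- by rewrite tlift_ptens // => ? ? ? ?; rewrite !linE.
- by move=> ?; apply: tlift_linear_fun => ? ? ? ? ?; rewrite !linE.
- by move=> ?; apply: tlift_linear_fun => ? ? ? ? ?; rewrite !linE.
Qed.

Lemma tube_pairing_elt_neq a b s t u v x y z w
    (mu : hom (irr s) (irr t ◁ irr b)) (gamma : hom (irr u ◁ irr b) (irr v))
    (nu : hom (irr x) (irr a ▷ irr y)) (zeta : hom (irr a ▷ irr z) (irr w)) :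
  (x, y, z, w) != (t, u, v, s) -> p (relt mu gamma) (lelt nu zeta) = 0.
Proof.
move=> ne; rewrite /tube_pairing.
rewrite (sum_only5 (i0 := b) (j0 := s) (l0 := t) (n0 := u) (q0 := v)); last first.
  move=> ? ? ? ? ? ne'; rewrite big1 // => ? _.
  by rewrite (rpart_relt_neq mu gamma) // tlift_0.
rewrite big1 // => ? _; apply: tlift_eq0 => ? ?.
rewrite lpart_lelt_neq ?tlift_0 //.
by apply: contraNneq ne => -[_ -> -> -> ->].
Qed.

Local Notation pval mu gamma nu zeta := (scal (zeta ∘ (idm _ ▷▷ gamma)
  ∘ mid _ _ _ ∘ (nu ◁◁ idm _) ∘ mu)).

(** Naturality brings each pair of dual basis vectors together on the leg [b' ⊗ b], where they sum
    to the identity; the right pentagon then splits this leg into [b'] and [b]. *)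
Lemma pval_rmul (t : dual_bases_system D) (a : C) (b b' : D) (s m u v m' u' : M)
    (mu : hom s (m ◁ b)) (gamma : hom (u ◁ b) v)
    (mu' : hom m (m' ◁ b')) (gamma' : hom (u' ◁ b') u)
    (nu : hom m' (a ▷ u')) (zeta : hom (a ▷ v) s) :
  \sum_k \sum_(i < db_size (t k (bobj (tens (uf_tens D)) b' b)))
    pval ((idm m' ◁◁ tnth (db' (t k _)) i) ∘ rassoc (br B) m' b' b
              ∘ (mu' ◁◁ idm b) ∘ mu)
         (gamma ∘ (gamma' ◁◁ idm b) ∘ (rassoc (br B) u' b' b)^†
              ∘ (idm u' ◁◁ tnth (db (t k _)) i)) nu zeta
  = pval mu gamma
      ((idm a ▷▷ gamma') ∘ mid a u' b' ∘ (nu ◁◁ idm b') ∘ mu') zeta.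
Proof.
(* The value of the diagram with an endomorphism [X] inserted on the leg [b' ⊗ b]. *)
pose Phi X := scal (zeta
  ∘ (idm a ▷▷ (gamma ∘ (gamma' ◁◁ idm b) ∘ (rassoc (br B) u' b' b)^†))
  ∘ mid a u' _ ∘ (nu ◁◁ X)
  ∘ (rassoc (br B) m' b' b ∘ (mu' ◁◁ idm b) ∘ mu)).
have Phil : linear (fun X => Phi X : K^o) by move=> c f g; rewrite /Phi !linE.
transitivity (Phi (idm _)).
  rewrite -(dual_bases_complete t (bobj _ b' b)) (lin_sum Phil); apply: eq_bigr => k _.
  rewrite (lin_sum Phil); apply: eq_bigr => i _; rewrite /Phi.
  set S := tnth (db _) i; set S' := tnth (db' _) i.
  have -> : nu ◁◁ (S ∘ S') = (idm (a ▷ u') ◁◁ S) ∘ (nu ◁◁ idm _) ∘ (idm m' ◁◁ S').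
    by rewrite -!bhom_comp !comp1m !compm1.
  have n : mid a u' _ ∘ (idm (a ▷ u') ◁◁ S) = (idm a ▷▷ (idm u' ◁◁ S)) ∘ mid a u' _.
    by rewrite (bm_nat ax) bhom_id.
  by rewrite !bhom_r_comp -!compA (comp_rw _ n).
rewrite /Phi !bhom_r_comp !bhom_l_comp -!compA; congr (scal (_ ∘ (_ ∘ _))).
have n : (nu ◁◁ idm _) ∘ rassoc (br B) m' b' b =
    rassoc (br B) (a ▷ u') b' b ∘ ((nu ◁◁ idm b') ◁◁ idm b).
  by rewrite -(bhom_id (tens (uf_tens D))) (rm_assoc_nat (ract_axioms _)).
have pent : (idm a ▷▷ (rassoc (br B) u' b' b)^†) ∘ mid a u' _
      ∘ rassoc (br B) (a ▷ u') b' b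
    = mid a (u' ◁ b') b ∘ (mid a u' b' ◁◁ idm b).
  rewrite -compA -(bm_pentagon_r ax) !compA -bhom_r_comp.
  by rewrite (unitaryE (rm_assoc_unitary (ract_axioms _) _ _ _)) bhom_id comp1m.
rewrite (comp_rw _ n) (compA (mid _ _ _)) (compA (idm a ▷▷ (rassoc _ _ _ _)^†)).
rewrite (compA (idm a ▷▷ (rassoc _ _ _ _)^†) (mid _ _ _)) pent -!compA.
by rewrite (comp_rw _ (bm_nat ax _ _ _)).
Qed.

(** Same argument on the leg [a ⊗ a'], with the left pentagon. *)
Lemma pval_lmul (t : dual_bases_system C) (a a' : C) (b : D) (x y z w y' z' : M)
    (nu : hom x (a ▷ y)) (zeta : hom (a ▷ z) w)
    (nu' : hom y (a' ▷ y')) (zeta' : hom (a' ▷ z') z)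
    (mu : hom w (x ◁ b)) (gamma : hom (y' ◁ b) z') :
  \sum_k \sum_(i < db_size (t k (bobj (tens (uf_tens C)) a a')))
    pval mu gamma
      ((tnth (db' (t k _)) i ▷▷ idm y') ∘ (lassoc (bl B) a a' y')^†
              ∘ (idm a ▷▷ nu') ∘ nu)
      (zeta ∘ (idm a ▷▷ zeta') ∘ lassoc (bl B) a a' z'
              ∘ (tnth (db (t k _)) i ▷▷ idm z'))
  = pval mu (zeta' ∘ (idm a' ▷▷ gamma) ∘ mid a' y' b ∘ (nu' ◁◁ idm b)) nu zeta.
Proof.
pose Phi X := scal (zeta ∘ (idm a ▷▷ zeta') ∘ lassoc (bl B) a a' z'
  ∘ (X ▷▷ gamma) ∘ mid _ y' b
  ∘ (((lassoc (bl B) a a' y')^† ∘ (idm a ▷▷ nu') ∘ nu) ◁◁ idm b) ∘ mu).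
have Phil : linear (fun X => Phi X : K^o) by move=> c f g; rewrite /Phi !linE.
transitivity (Phi (idm _)).
  rewrite -(dual_bases_complete t (bobj _ a a')) (lin_sum Phil); apply: eq_bigr => k _.
  rewrite (lin_sum Phil); apply: eq_bigr => i _; rewrite /Phi.
  set S := tnth (db _) i; set S' := tnth (db' _) i.
  have -> : (S ∘ S') ▷▷ gamma
      = (S ▷▷ idm z') ∘ (idm _ ▷▷ gamma) ∘ (S' ▷▷ idm (y' ◁ b)).
    by rewrite -!bhom_comp !comp1m !compm1.
  have n : (S' ▷▷ idm (y' ◁ b)) ∘ mid _ y' b
      = mid _ y' b ∘ ((S' ▷▷ idm y') ◁◁ idm b).
    by rewrite -(bm_nat ax) bhom_id.
  by rewrite !bhom_l_comp -!compA (comp_rw _ n).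
rewrite /Phi !bhom_r_comp !bhom_l_comp -!compA; congr (scal (_ ∘ (_ ∘ _))).
have n : lassoc (bl B) a a' z' ∘ (idm _ ▷▷ gamma) =
    (idm a ▷▷ (idm a' ▷▷ gamma)) ∘ lassoc (bl B) a a' (y' ◁ b).
  by rewrite -(bhom_id (tens (uf_tens C))) (lm_assoc_nat (lact_axioms _)).
have pent : lassoc (bl B) a a' (y' ◁ b) ∘ mid _ y' b
      ∘ ((lassoc (bl B) a a' y')^† ◁◁ idm b)
    = (idm a ▷▷ mid a' y' b) ∘ mid a (a' ▷ y') b.
  rewrite -(bm_pentagon_l ax) -compA -bhom_l_comp.
  by rewrite (unitaryV (lm_assoc_unitary (lact_axioms _) _ _ _)) bhom_id compm1.
rewrite (comp_rw _ n); congr (_ ∘ _).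
rewrite (compA (mid _ _ _)) (compA (lassoc _ _ _ _)).
rewrite (compA (lassoc _ _ _ _) (mid _ _ _)) pent -!compA.
by rewrite (comp_rw _ (esym (bm_nat ax _ _ _))).
Qed.

(** Moving [i] through the diagram cancels it against [i^†]; by the right triangle the two unitors
    then cancel as well. *)
Lemma pval_unit_right (e : D) (i : hom (tone (uf_tens D)) e) (a : C) (x y w : M)
    (nu : hom x (a ▷ y)) (zeta : hom (a ▷ y) w) :
  unitary i ->
  zeta ∘ (idm a ▷▷ (runit (br B) y ∘ (idm y ◁◁ i^†))) ∘ mid a y e
    ∘ (nu ◁◁ idm e) ∘ ((idm x ◁◁ i) ∘ (runit (br B) x)^†) = zeta ∘ nu.
Proof.
move=> iu; rewrite bhom_r_comp -!compA; congr (_ ∘ _).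
rewrite (comp_rw _ (bhom_exchange _ _ _)) runit_nat_dag.
have n : mid a y e ∘ (idm (a ▷ y) ◁◁ i) = (idm a ▷▷ (idm y ◁◁ i)) ∘ mid a y _.
  by rewrite (bm_nat ax) bhom_id.
have ii : (idm a ▷▷ (idm y ◁◁ i^†)) ∘ (idm a ▷▷ (idm y ◁◁ i)) = idm _.
  by rewrite -!bhom_r_comp (unitaryE iu) !bhom_id.
rewrite (comp_rw _ n) (comp_rw1 _ ii) comp1m.
rewrite (comp_rw1 _ (bm_triangle_r ax _ _)).
exact: unitaryVKl (rm_unit_unitary (ract_axioms _) _).
Qed.

Lemma pval_unit_left (e : C) (i : hom (tone (uf_tens C)) e) (b : D) (s t v : M)
    (mu : hom s (t ◁ b)) (gamma : hom (t ◁ b) v) :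
  unitary i ->
  lunit (bl B) v ∘ (i^† ▷▷ idm v) ∘ (idm e ▷▷ gamma) ∘ mid e t b
    ∘ (((i ▷▷ idm t) ∘ (lunit (bl B) t)^†) ◁◁ idm b) ∘ mu = gamma ∘ mu.
Proof.
move=> iu; rewrite bhom_l_comp -!compA.
have n : mid e t b ∘ ((i ▷▷ idm t) ◁◁ idm b) = (i ▷▷ idm (t ◁ b)) ∘ mid _ t b.
  by rewrite -(bm_nat ax) bhom_id.
rewrite (comp_rw _ n) (comp_rw _ (bhom_exchange _ _ _)).
rewrite (comp_rw1 _ (esym (bhom_l_comp _ _ _ _))) (unitaryE iu) bhom_id comp1m.
rewrite (comp_rw _ (esym (lm_unit_nat (lact_axioms _) _))).
rewrite (comp_rw1 _ (bm_triangle_l ax _ _)) (comp_rw1 _ (esym (bhom_l_comp _ _ _ _))).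
by rewrite (unitaryV (lm_unit_unitary (lact_axioms _) _)) bhom_id comp1m.
Qed.

Variables (sC : standard_data C) (sD : standard_data D).
Variables (tC : dual_bases_system C) (tD : dual_bases_system D).
Variables (tM : dual_bases_system M) (d : Irr M -> K).

Lemma left_module_trace (a : Irr C) (u n : Irr M)
    (g : hom (irr n) (irr a ▷ irr u)) (h : hom (irr a ▷ irr u) (irr n)) :
  left_dims (bl B) sC d ->
  d u * scal ((lcoev (bl B) (st_R sC a) (irr u))^† ∘ (idm _ ▷▷ (g ∘ h))
              ∘ lcoev (bl B) (st_R sC a) (irr u)) = d n * scal (h ∘ g).
Proof.
move=> [d0 dd].
apply: (@module_trace _ _ (act_left (irr a) (lact (bl B)))
  (act_left (irr (bar sC a)) (lact (bl B))) (lcoev (bl B) (st_R sC a))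
  (lcoev (bl B) (st_R' sC a)) _ _ (qdim sC a) d tM) => //.
- by move=> x y f; apply: lcoev_nat.
- by move=> m; apply/lcoev_zigzag/st_conj.
- by move=> m; apply/lcoev_dim/st_R_dim.
- by move=> m; apply/lcoev_dim/st_R'_dim.
Qed.

Lemma right_module_trace (b : Irr D) (u n : Irr M)
    (g : hom (irr n) (irr u ◁ irr b)) (h : hom (irr u ◁ irr b) (irr n)) :
  right_dims (br B) sD d ->
  d u * scal ((rcoev (br B) (st_R' sD b) (irr u))^† ∘ ((g ∘ h) ◁◁ idm _)
              ∘ rcoev (br B) (st_R' sD b) (irr u)) = d n * scal (h ∘ g).
Proof.
move=> [d0 dd].
apply: (@module_trace _ _ (act_right (irr b) (ract (br B)))
  (act_right (irr (bar sD b)) (ract (br B))) (rcoev (br B) (st_R' sD b))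
  (rcoev (br B) (st_R sD b)) _ _ (qdim sD b) d tM) => //.
- by move=> x y f; apply: rcoev_nat.
- by move=> m; apply/rcoev_zigzag/st_conj.
- by move=> m; apply/rcoev_dim/st_R'_dim.
- by move=> m; apply/rcoev_dim/st_R_dim.
- by move=> m; rewrite mulrC; apply: dd.
Qed.

(** After composition with an invertible associator, [lcoev_act] on one side and [rcoev_act] on the
    other leave only naturality of the left coevaluation. *)
Lemma lcoev_rcoev (a a' : C) (b b' : D) (R : hom (tone (uf_tens C)) _)
    (R' : hom (tone (uf_tens D)) _) (u : M) :
  mid a' (a ▷ (u ◁ b)) b' ∘ (lcoev (bl B) R (u ◁ b) ◁◁ idm b')
    ∘ rcoev (br B) R' u
  = (idm a' ▷▷ ((mid a u b ◁◁ idm b') ∘ rcoev (br B) R' (a ▷ u)))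
    ∘ lcoev (bl B) R u.
Proof.
apply: (unitary_injl (bhom_unitary (lact (bl B)) (unitary_id a')
  (bm_unitary ax a (u ◁ b) b'))).
rewrite !compA lcoev_act -lcoev_nat -bhom_r_comp !compA.
by rewrite rcoev_act.
Qed.

(** Two applications of the module trace property: the trace over [b] moves [mu] around the diagram
    and replaces [d t] by [d s], the one over [a] moves [nu] and replaces [d u] by [d t]. *)
Lemma pval_antipode (a : Irr C) (b : Irr D) (s t u v : Irr M)
    (mu : hom (irr s) (irr t ◁ irr b)) (gamma : hom (irr u ◁ irr b) (irr v))
    (nu : hom (irr t) (irr a ▷ irr u)) (zeta : hom (irr a ▷ irr v) (irr s)) :
  left_dims (bl B) sC d -> right_dims (br B) sD d ->
  d u * pval ((gamma ◁◁ idm (irr (bar sD b))) ∘ rcoev (br B) (st_R' sD b) (irr u))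
    ((rcoev (br B) (st_R' sD b) (irr t))^† ∘ (mu ◁◁ idm (irr (bar sD b))))
    ((idm (irr (bar sC a)) ▷▷ zeta) ∘ lcoev (bl B) (st_R sC a) (irr v))
    ((lcoev (bl B) (st_R sC a) (irr u))^† ∘ (idm (irr (bar sC a)) ▷▷ nu))
  = d s * pval mu gamma nu zeta.
Proof.
move=> hL hR; set eta := lcoev (bl B) (st_R sC a).
set theta := rcoev (br B) (st_R' sD b).
(* The diagram without [nu], with the leg [b] already closed on the right. *)
pose W : hom (irr a ▷ irr u) (irr t) := (theta (irr t))^†
  ∘ ((mu ∘ zeta ∘ (idm (irr a) ▷▷ gamma) ∘ mid _ _ _) ◁◁ idm _)
  ∘ theta (irr a ▷ irr u).
(* The bent diagram of the two antipodes, apart from its last factor, is [W] with the leg [a] bent;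
   [lcoev_rcoev] exchanges the two bendings. *)
have WE : (idm _ ▷▷ W) ∘ eta (irr u)
  = (idm _ ▷▷ ((theta (irr t))^† ∘ (mu ◁◁ idm _))) ∘ mid _ _ _
    ∘ (((idm _ ▷▷ zeta) ∘ eta (irr v)) ◁◁ idm _)
    ∘ ((gamma ◁◁ idm _) ∘ theta (irr u)).
  rewrite /W !bhom_l_comp !bhom_r_comp -!compA.
  have := lcoev_rcoev (st_R sC a) (st_R' sD b) (irr u).
  rewrite -/theta -/eta bhom_r_comp -!compA => <-.
  congr (_ ∘ (_ ∘ _)).
  rewrite (comp_rw _ (esym (bm_nat ax _ _ _))); congr (_ ∘ _).
  rewrite (comp_rw1 _ (esym (bhom_l_comp _ _ _ _))) -lcoev_nat bhom_l_comp.
  by rewrite -!compA (comp_rw _ (esym (bm_nat ax _ _ _))).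
have Wnu : d t * scal (W ∘ nu) = d s * pval mu gamma nu zeta.
  rewrite /W -!compA -(rcoev_nat (br B) _ nu) -/theta.
  transitivity (d t * scal ((theta (irr t))^† ∘ ((mu ∘ (zeta ∘ (idm _ ▷▷ gamma)
      ∘ mid _ _ _ ∘ (nu ◁◁ idm _))) ◁◁ idm _) ∘ theta (irr t))).
    by rewrite !bhom_l_comp -!compA.
  by rewrite (right_module_trace _ _ hR) -!compA.
clearbody W; rewrite -Wnu -(left_module_trace _ _ hL) -/eta.
congr (_ * scal _); apply/esym.
rewrite bhom_r_comp -2!compA WE -/eta -/theta -!compA.
by [].
Qed.

Lemma tube_pairing_1l l : p (rtube_one (br B) sD) l = ltube_counit l.
Proof.
apply: (ltube_ext (E := K^o) (tube_pairing_linr _) (@ltube_counit_linear _ _ _ _)).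
move=> a x y z w nu zeta; rewrite /rtube_one.
rewrite (lin_sum (tube_pairing_linl (lelt nu zeta))).
have [e|ne] := eqVneq (z, w) (y, x); last first.
  rewrite ltube_counit_lelt_neq // big1 // => s _.
  rewrite (lin_sum (tube_pairing_linl (lelt nu zeta))) big1 // => u _.
  by rewrite tube_pairing_elt_neq //; apply: contraNneq ne => -[-> -> -> ->].
case: e => ? ?; subst z w; rewrite ltube_counit_lelt (sum_only1 (i0 := x)).
  rewrite (lin_sum (tube_pairing_linl (lelt nu zeta))) (sum_only1 (i0 := y)).
    by rewrite tube_pairing_elt pval_unit_right //; apply: st_iso_unitary.
  move=> u ne; rewrite tube_pairing_elt_neq //.
  by apply: contraNneq ne => -[->].
move=> s ne; rewrite (lin_sum (tube_pairing_linl (lelt nu zeta))) big1 // => u _.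
by rewrite tube_pairing_elt_neq //; apply: contraNneq ne => -[->].
Qed.

Lemma tube_pairing_1r r : p r (ltube_one (bl B) sC) = rtube_counit r.
Proof.
apply: (rtube_ext (E := K^o) (tube_pairing_linl _) (@rtube_counit_linear _ _ _ _)).
move=> b s t u v mu gamma; rewrite /ltube_one.
rewrite (lin_sum (tube_pairing_linr (relt mu gamma))).
have [e|ne] := eqVneq (u, v) (t, s); last first.
  rewrite rtube_counit_relt_neq // big1 // => x _.
  rewrite (lin_sum (tube_pairing_linr (relt mu gamma))) big1 // => z _.
  by rewrite tube_pairing_elt_neq //; apply: contraNneq ne => -[-> -> -> ->].
case: e => ? ?; subst u v; rewrite rtube_counit_relt (sum_only1 (i0 := t)).
  rewrite (lin_sum (tube_pairing_linr (relt mu gamma))) (sum_only1 (i0 := s)).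
    by rewrite tube_pairing_elt pval_unit_left //; apply: st_iso_unitary.
  move=> z ne; rewrite tube_pairing_elt_neq //.
  by apply: contraNneq ne => -[->].
move=> x ne; rewrite (lin_sum (tube_pairing_linr (relt mu gamma))) big1 // => z _.
by rewrite tube_pairing_elt_neq //; apply: contraNneq ne => -[->].
Qed.

Lemma tlift_ltube_comul (f : ltube (bl B) -> ltube (bl B) -> K^o) a x y z w
    (nu : hom (irr x) (irr a ▷ irr y)) (zeta : hom (irr a ▷ irr z) (irr w)) :
  (forall l, linear (f^~ l)) -> (forall l, linear (f l)) ->
  tlift f (ltube_comul tM (lelt nu zeta)) =
    \sum_i \sum_k \sum_(j < db_size (tM k (irr a ▷ irr i)))
      f (lelt (tnth (db (tM k (irr a ▷ irr i))) j) zeta)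
        (lelt nu (tnth (db' (tM k (irr a ▷ irr i))) j)).
Proof.
move=> fl fr; rewrite ltube_comul_lelt.
do 3 (rewrite (lin_sum (@tlift_linear _ _ _ _ _)); apply: eq_bigr => ? _).
exact: tlift_ptens.
Qed.

Lemma tlift_rtube_comul (f : rtube (br B) -> rtube (br B) -> K^o) b s t u v
    (mu : hom (irr s) (irr t ◁ irr b)) (gamma : hom (irr u ◁ irr b) (irr v)) :
  (forall l, linear (f^~ l)) -> (forall l, linear (f l)) ->
  tlift f (rtube_comul tM (relt mu gamma)) =
    \sum_i \sum_k \sum_(j < db_size (tM k (irr i ◁ irr b)))
      f (relt (tnth (db (tM k (irr i ◁ irr b))) j) gamma)
        (relt mu (tnth (db' (tM k (irr i ◁ irr b))) j)).
Proof.
move=> fl fr; rewrite rtube_comul_relt.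
do 3 (rewrite (lin_sum (@tlift_linear _ _ _ _ _)); apply: eq_bigr => ? _).
exact: tlift_ptens.
Qed.

Lemma linear_mull (E : lmodType K) (f : E -> K^o) c :
  linear f -> linear (fun g => f g * c : K^o).
Proof. by move=> fl k g h; rewrite fl mulrDl -mulrA. Qed.

Lemma linear_mulr (E : lmodType K) (f : E -> K^o) c :
  linear f -> linear (fun g => c * f g : K^o).
Proof. by move=> fl k g h; rewrite fl mulrDr [c * (_ *: _)]mulrCA. Qed.

(** On pure tensors with matching labels, [pval_rmul] nests the diagram of [r'] inside that of [r].
    The coproduct cuts it at the simple object [t], by expanding the inner morphism in dual
    bases. *)
Lemma tube_pairing_Ml r r' l :
  p (rtube_mul tD r r') l =
    tlift (fun l1 l2 => p r l1 * p r' l2 : K^o) (ltube_comul tM l).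
Proof.
have lin_r l1 : linear (fun r => p r l1 : K^o) := tube_pairing_linl l1.
have lin_l r1 : linear (fun l => p r1 l : K^o) := tube_pairing_linr r1.
move: r; apply: (rtube_ext (E := K^o)).
- exact: linear_o (lin_r _) (@rtube_mul_linl _ _ _ _ _ _).
- by apply: tlift_linear_fun => ? ?; apply: linear_mull.
move=> b s t u v mu gamma; move: r'; apply: (rtube_ext (E := K^o)).
- exact: linear_o (lin_r _) (@rtube_mul_linr _ _ _ _ _ _).
- by apply: tlift_linear_fun => ? ?; apply: linear_mulr.
move=> b' s' t' u' v' mu' gamma'; move: l; apply: (ltube_ext (E := K^o)).
- exact: lin_l.
- exact: linear_o (@tlift_linear _ _ _ _ _) (@ltube_comul_linear _ _ _ _ _).
move=> a x y z w nu zeta; rewrite tlift_ltube_comul; last 2 first.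
- by move=> ?; apply: linear_mull.
- by move=> ?; apply: linear_mulr.
(* The label conditions under which either side can be nonzero; outside them both vanish. *)
have [e|ne] := eqVneq (x, y, z, w, s', v') (t', u', v, s, t, u); last first.
  transitivity (0 : K^o); last first.
    apply/esym; rewrite big1 // => i _; rewrite big1 // => k _; rewrite big1 // => j _.
    have [e1|ne1] := eqVneq (k, i, z, w) (t, u, v, s); last first.
      by rewrite tube_pairing_elt_neq ?mul0r.
    have [e2|ne2] := eqVneq (x, y, i, k) (t', u', v', s'); last first.
      by rewrite [X in _ * X]tube_pairing_elt_neq ?mulr0.
    by case/negP: ne; case: e1 e2 => <- <- -> -> [-> -> -> ->].
  have [e|ne'] := eqVneq (s', v') (t, u); last first.
    by rewrite rtube_mul_relt_neq // (lin0 (lin_r _)).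
  case: e ne => ? ?; subst s' v' => ne; rewrite rtube_mul_relt (lin_sum (lin_r _)).
  rewrite big1 // => k _; rewrite (lin_sum (lin_r _)) big1 // => j _.
  by rewrite tube_pairing_elt_neq //; apply: contraNneq ne => -[-> -> -> ->].
case: e => ? ? ? ? ? ?; subst x y z w s' v'.
rewrite rtube_mul_relt (lin_sum (lin_r _)).
under eq_bigr => k _.
  rewrite (lin_sum (lin_r _)).
  under eq_bigr => j _ do rewrite tube_pairing_elt.
  over.
rewrite [LHS]pval_rmul (sum_only1 (i0 := u)) => [|i ne]; last first.
  rewrite big1 // => k _; rewrite big1 // => j _.
  by rewrite tube_pairing_elt_neq ?mul0r //; apply: contraNneq ne => -[_ ->].
rewrite (sum_only1 (i0 := t)) => [|k ne]; last first.
  rewrite big1 // => j _.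
  by rewrite tube_pairing_elt_neq ?mul0r //; apply: contraNneq ne => -[->].
(* The coefficients of [X] are the values of the pairing with [r'], and the basis vectors take the
   place of [nu] in the pairing with [r]. *)
set X := _ ∘ mu'; rewrite -[X](dual_basis_expand (tM t _) _ (irr_simple t)).
pose Phi Y := pval mu gamma Y zeta.
have Phil : linear (fun Y => Phi Y : K^o) by move=> c f g; rewrite /Phi !linE.
rewrite [LHS](lin_sum Phil); apply: eq_bigr => j _.
rewrite !tube_pairing_elt [LHS](linZ Phil) [LHS]mulrC; congr (_ * scal _).
by rewrite /X !compA.
Qed.

(** Mirror image of [tube_pairing_Ml]: the inner morphism now ends in the simple object [z], so it
    is expanded in the bases of morphisms into [z]. *)
Lemma tube_pairing_Mr r l l' :
  p r (ltube_mul tC l l') =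
    tlift (fun r1 r2 => p r2 l * p r1 l' : K^o) (rtube_comul tM r).
Proof.
have lin_r l1 : linear (fun r => p r l1 : K^o) := tube_pairing_linl l1.
have lin_l r1 : linear (fun l => p r1 l : K^o) := tube_pairing_linr r1.
move: l; apply: (ltube_ext (E := K^o)).
- exact: linear_o (lin_l _) (@ltube_mul_linl _ _ _ _ _ _).
- by apply: tlift_linear_fun => ? ?; apply: linear_mull.
move=> a x y z w nu zeta; move: l'; apply: (ltube_ext (E := K^o)).
- exact: linear_o (lin_l _) (@ltube_mul_linr _ _ _ _ _ _).
- by apply: tlift_linear_fun => ? ?; apply: linear_mulr.
move=> a' x' y' z' w' nu' zeta'; move: r; apply: (rtube_ext (E := K^o)).
- exact: lin_r.
- exact: linear_o (@tlift_linear _ _ _ _ _) (@rtube_comul_linear _ _ _ _ _).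
move=> b s t u v mu gamma; rewrite tlift_rtube_comul; last 2 first.
- by move=> ?; apply: linear_mulr.
- by move=> ?; apply: linear_mull.
have [e|ne] := eqVneq (s, t, u, v, x', w') (w, x, y', z', y, z); last first.
  transitivity (0 : K^o); last first.
    apply/esym; rewrite big1 // => i _; rewrite big1 // => k _; rewrite big1 // => j _.
    have [e1|ne1] := eqVneq (x, y, z, w) (t, i, k, s); last first.
      by rewrite tube_pairing_elt_neq ?mul0r.
    have [e2|ne2] := eqVneq (x', y', z', w') (i, u, v, k); last first.
      by rewrite [X in _ * X]tube_pairing_elt_neq ?mulr0.
    case: e1 e2 => ? ? ? ? [? ? ? ?]; subst.
    by rewrite eqxx in ne.
  have [e|ne'] := eqVneq (x', w') (y, z); last first.
    by rewrite ltube_mul_lelt_neq // (lin0 (lin_l _)).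
  case: e ne => ? ?; subst x' w' => ne; rewrite ltube_mul_lelt (lin_sum (lin_l _)).
  rewrite big1 // => k _; rewrite (lin_sum (lin_l _)) big1 // => j _.
  by rewrite tube_pairing_elt_neq //; apply: contraNneq ne => -[-> -> -> ->].
case: e => ? ? ? ? ? ?; subst s t u v x' w'.
rewrite ltube_mul_lelt (lin_sum (lin_l _)).
under eq_bigr => k _.
  rewrite (lin_sum (lin_l _)).
  under eq_bigr => j _ do rewrite tube_pairing_elt.
  over.
rewrite [LHS]pval_lmul (sum_only1 (i0 := y)) => [|i ne]; last first.
  rewrite big1 // => k _; rewrite big1 // => j _.
  by rewrite tube_pairing_elt_neq ?mul0r //; apply: contraNneq ne => -[->].
rewrite (sum_only1 (i0 := z)) => [|k ne]; last first.
  rewrite big1 // => j _.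
  by rewrite tube_pairing_elt_neq ?mul0r //; apply: contraNneq ne => -[->].
set X := _ ∘ (nu' ◁◁ _); rewrite -[X](dual_basis_expand' (tM z _) _ (irr_simple z)).
pose Phi Y := pval mu Y nu zeta.
have Phil : linear (fun Y => Phi Y : K^o) by move=> c f g; rewrite /Phi !linE.
rewrite [LHS](lin_sum Phil); apply: eq_bigr => j _.
by rewrite !tube_pairing_elt [LHS](linZ Phil) [LHS]mulrC.
Qed.

(** This symmetric form of the antipode axiom involves no inverse, so it can be checked on pure
    tensors. *)
Lemma tube_pairing_antipode r l :
  left_dims (bl B) sC d -> right_dims (br B) sD d ->
  p (rtube_antipode sD d r) (ltube_antipode sC d l) = p r l.
Proof.
move=> hL hR; have d0 m : d m != 0 by rewrite gt_eqF //; case: hL.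
have lin_r l1 : linear (fun r => p r l1 : K^o) := tube_pairing_linl l1.
have lin_l r1 : linear (fun l => p r1 l : K^o) := tube_pairing_linr r1.
move: r; apply: (rtube_ext (E := K^o)).
- exact: linear_o (lin_r _) (@rtube_antipode_linear _ _ _ _ _ _).
- exact: lin_r.
move=> b s t u v mu gamma; move: l; apply: (ltube_ext (E := K^o)).
- exact: linear_o (lin_l _) (@ltube_antipode_linear _ _ _ _ _ _).
- exact: lin_l.
move=> a x y z w nu zeta; rewrite rtube_antipode_relt ltube_antipode_lelt.
rewrite (linZ (lin_r _)) (linZ (lin_l _)).
have [e|ne] := eqVneq (x, y, z, w) (t, u, v, s); last first.
  rewrite !tube_pairing_elt_neq ?scaler0 //.
  by apply: contraNneq ne => -[-> -> -> ->].
case: e => ? ? ? ?; subst x y z w; rewrite !tube_pairing_elt.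
apply: (mulfI (d0 s)); rewrite -pval_antipode //.
set P := scal _.
(* The prefactors of the two antipodes multiply to [d u / d s], the ratio in [pval_antipode]. *)
change (d s * (d u / d v * (d v / d s * P)) = d u * P).
by field; rewrite !d0.
Qed.

End Pairing.

Theorem proposition17 (R : realType) (C D : unitaryFusionCat R[i])
    (M : semisimpleCat R[i]) (B : bimodule C D M) (hB : indecomposable B)
    (sC : standard_data C) (sD : standard_data D)
    (tC : dual_bases_system C) (tD : dual_bases_system D)
    (tM : dual_bases_system M)
    (dL dR d : Irr M -> R[i])
    (hL : left_dims (bl B) sC dL) (hR : right_dims (br B) sD dR)
    (hLd : forall m, dL m = d m) (hRd : forall m, dR m = d m) :
  skew_pairing (U := right_tube (br B) sD tD tM d)
    (V := left_tube (bl B) sC tC tM d) (@tube_pairing R[i] C D M B).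
Proof.
have {}hL : left_dims (bl B) sC d.
  case: hL => d0 dd; split=> [m|a m]; first by rewrite -hLd.
  by rewrite -hLd dd; apply: eq_bigr => n _; rewrite hLd.
have {}hR : right_dims (br B) sD d.
  case: hR => d0 dd; split=> [m|m b]; first by rewrite -hRd.
  by rewrite -hRd dd; apply: eq_bigr => n _; rewrite hRd.
have d0 m : d m != 0 by rewrite gt_eqF //; case: hL.
have bijU : bijective (rtube_antipode (G := br B) sD d).
  by apply: linear_surj_bij (rtube_antipode_surj sD d0); apply: rtube_antipode_linear.
have [Sinv SK SinvK] : bijective (ltube_antipode (L := bl B) sC d).
  by apply: linear_surj_bij (ltube_antipode_surj sC d0); apply: ltube_antipode_linear.
split=> //.
- by move=> v; apply: tube_pairing_linl.
- by move=> u; apply: tube_pairing_linr.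
- by move=> v; apply: tube_pairing_1l.
- by move=> u; apply: tube_pairing_1r.
- by move=> u u' v; apply: tube_pairing_Ml.
- by move=> u v v'; apply: tube_pairing_Mr.
exists Sinv; split; [exact: SK | exact: SinvK |] => u v.
(* The symmetric form evaluated at [Sinv v] is the required identity. *)
have := tube_pairing_antipode tM u (Sinv v) hL hR; rewrite (SinvK v); exact.
Qed.
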